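(* Let $V$ be a graded vertex coalgebra and let a ($\mathbb{Q}$-graded) vector space $M$ with a linear map $\mathcal{Y}_M(x):M\to(V\otimes M)[[x,x^{-1}]]$ satisfy all the axioms of being a comodule over $V$ except the Jacobi identity, but also satisfy weak coassociativity: for every $v'\in(V\otimes V\otimes M)'$ there exists $k\in\mathbb{Z}_+$ such that for all $w\in M$ $$(x_0+x_2)^k\langle v',(\mathcal{Y}_V(x_0)\otimes Id_M)\mathcal{Y}_M(x_2)w-(Id_V\otimes\mathcal{Y}_M(x_2))\mathcal{Y}_M(x_0+x_2)w\rangle=0.$$ Then $M$ satisfies the Jacobi identity: $$x_0^{-1}\delta\left(\tfrac{x_1-x_2}{x_0}\right)(Id_V\otimes\mathcal{Y}_M(x_2))\mathcal{Y}_M(x_1)-x_0^{-1}\delta\left(\tfrac{x_2-x_1}{-x_0}\right)(T\otimes Id_M)(Id_V\otimes\mathcal{Y}_M(x_1))\mathcal{Y}_M(x_2)=x_2^{-1}\delta\left(\tfrac{x_1-x_0}{x_2}\right)(\mathcal{Y}_V(x_0)\otimes Id_M)\mathcal{Y}_M(x_2).$$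
   Context: All vector spaces are over a field $\mathbb{F}$ of characteristic $0$; $x,x_0,x_1,x_2$ are commuting formal variables; $\mathbb{Z}_+$ is the set of positive integers. $\delta(x)=\sum_{n\in\mathbb{Z}}x^n$. For $n\in\mathbb{Z}$, $(x_i\pm x_j)^n$ is expanded in nonnegative integral powers of the second listed variable $x_j$ (this also applies inside $\delta$ and to $\mathcal{Y}_M(x_0+x_2)$). $W[[x,x^{-1}]]$ is the space of all doubly infinite formal series with coefficients in $W$, and $W((x^{-1}))$ is the space of those with only finitely many positive powers of $x$. $T(u\otimes v)=v\otimes u$ on $V\otimes V$. Linear maps and pairings act on formal series coefficientwise. A vertex coalgebra $(V,\mathcal{Y}_V,c)$ is a vector space $V$ with linear maps $\mathcal{Y}_V(x):V\to(V\otimes V)[[x,x^{-1}]]$ and $c:V\to\mathbb{F}$ such that for all $v\in V$: (left counit) $(c\otimes Id_V)\mathcal{Y}_V(x)v=v$; (cocreation) $(Id_V\otimes c)\mathcal{Y}_V(x)v\in V[[x]]$ and $\lim_{x\to0}(Id_V\otimes c)\mathcal{Y}_V(x)v=v$; (truncation) $\mathcal{Y}_V(x)v\in(V\otimes V)((x^{-1}))$; (Jacobi identity) $$x_0^{-1}\delta\left(\tfrac{x_1-x_2}{x_0}\right)(Id_V\otimes\mathcal{Y}_V(x_2))\mathcal{Y}_V(x_1)-x_0^{-1}\delta\left(\tfrac{x_2-x_1}{-x_0}\right)(T\otimes Id_V)(Id_V\otimes\mathcal{Y}_V(x_1))\mathcal{Y}_V(x_2)=x_2^{-1}\delta\left(\tfrac{x_1-x_0}{x_2}\right)(\mathcal{Y}_V(x_0)\otimes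 Id_V)\mathcal{Y}_V(x_2).$$ It is a graded vertex coalgebra if $V=\coprod_{k\in\mathbb{Z}}V_{(k)}$ is $\mathbb{Z}$-graded with $V_{(k)}=0$ for $k$ sufficiently negative and, writing $\mathcal{Y}_V(x)v=\sum_{k\in\mathbb{Z}}\Delta_k(v)x^{-k-1}$, $\Delta_k(v)\in(V\otimes V)_{(r+k+1)}$ for all $v\in V_{(r)}$, $r,k\in\mathbb{Z}$. The axioms of a comodule $M$ over a graded vertex coalgebra $V$ other than the Jacobi identity are: $M=\coprod_{j\in\mathbb{Q}}M_{(j)}$ is a $\mathbb{Q}$-graded vector space with $M_{(j)}=0$ for $j$ sufficiently negative; writing $\mathcal{Y}_M(x)w=\sum_{k\in\mathbb{Z}}\Delta_k(w)x^{-k-1}$, $\Delta_k(w)\in(V\otimes M)_{(j+k+1)}$ for $w\in M_{(j)}$; and for all $w\in M$: (left counit) $(c\otimes Id_M)\mathcal{Y}_M(x)w=w$; (truncation) $\mathcal{Y}_M(x)w\in(V\otimes M)((x^{-1}))$. For a graded space $W=\coprod_k W_{(k)}$, the graded dual is $W'=\coprod_k\mathrm{Hom}(W_{(k)},\mathbb{F})$, and $\langle\cdot,\cdot\rangle$ is the natural pairing of $W'$ with $W$. Tensor products are graded by total weight. *)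

(* Defs.v *)
From HB Require Import structures.
From mathcomp Require Import all_boot all_order all_algebra.
From mathcomp Require Import sesquilinear boolp classical_sets functions fsbigop.

Set Implicit Arguments.
Unset Strict Implicit.
Unset Printing Implicit Defensive.

Import GRing.Theory.
Local Open Scope quotient_scope.
Local Open Scope classical_set_scope.
Local Open Scope ring_scope.

(* A formal sum [:: (v1, w1); ...; (vn, wn)] stands for v1 ⊗ w1 + ... +
   vn ⊗ wn; scalars are absorbed in the left factors.  [tens_eq] is the
   congruence generated by commutativity and bilinearity.                   *)
Inductive tens_eq (F : fieldType) (V W : lmodType F) :
    seq (V * W) -> seq (V * W) -> Prop :=
| tens_refl s : tens_eq s s
| tens_sym s t : tens_eq s t -> tens_eq t s
| tens_trans s t u : tens_eq s t -> tens_eq t u -> tens_eq s u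
| tens_cat s s' t t' :
    tens_eq s s' -> tens_eq t t' -> tens_eq (s ++ t) (s' ++ t')
| tens_comm s t : tens_eq (s ++ t) (t ++ s)
| tens_addl v v' w : tens_eq [:: (v + v', w)] [:: (v, w); (v', w)]
| tens_addr v w w' : tens_eq [:: (v, w + w')] [:: (v, w); (v, w')]
| tens_scale a v w : tens_eq [:: (a *: v, w)] [:: (v, a *: w)]
| tens_zero w : tens_eq [:: (0, w)] [::].

Section Tensor.
Variables (F : fieldType) (V W : lmodType F).

Definition tens_rel : rel (seq (V * W)) := fun s t => `[< tens_eq s t >].

Lemma tens_rel_refl : reflexive tens_rel.
Proof. by move=> s; apply/asboolP/tens_refl. Qed.

Lemma tens_rel_sym : symmetric tens_rel.
Proof. by move=> s t; apply/asboolP/asboolP; apply: tens_sym. Qed.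

Lemma tens_rel_trans : transitive tens_rel.
Proof.
by move=> t s u /asboolP st /asboolP tu; apply/asboolP/(tens_trans st tu).
Qed.

Canonical tens_equiv := EquivRel tens_rel tens_rel_refl tens_rel_sym
  tens_rel_trans.

Definition tensor : Type := {eq_quot tens_equiv}.
HB.instance Definition _ := Choice.on tensor.

Definition tcls (s : seq (V * W)) : tensor := \pi_({eq_quot tens_equiv}) s.
Definition trep (t : tensor) : seq (V * W) :=
  repr (t : {eq_quot tens_equiv}).

Lemma trepK t : tcls (trep t) = t. Proof. exact: reprK. Qed.

Lemma tcls_eq s t : tcls s = tcls t <-> tens_eq s t.
Proof. by split=> [/eqmodP/asboolP | st] //; apply/eqmodP/asboolP. Qed.

Lemma trep_cls s : tens_eq (trep (tcls s)) s.
Proof. by apply/tcls_eq; rewrite trepK. Qed.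

Lemma tens_eq_map (h : V * W -> V * W) :
  (forall v v' w, tens_eq [:: h (v + v', w)] [:: h (v, w); h (v', w)]) ->
  (forall v w w', tens_eq [:: h (v, w + w')] [:: h (v, w); h (v, w')]) ->
  (forall a v w, tens_eq [:: h (a *: v, w)] [:: h (v, a *: w)]) ->
  (forall w, tens_eq [:: h (0, w)] [::]) ->
  forall s t, tens_eq s t -> tens_eq (map h s) (map h t).
Proof.
move=> hDl hDr hZ h0 s t; elim=> {s t} //=.
- by move=> *; apply: tens_refl.
- by move=> s t _; apply: tens_sym.
- by move=> s t u _ st _; apply: tens_trans.
- by move=> s s' t t' _ ss' _ tt'; rewrite !map_cat; apply: tens_cat.
- by move=> s t; rewrite !map_cat; apply: tens_comm.
Qed.

Definition tens_scalef (a : F) (p : V * W) : V * W := (a *: p.1, p.2).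

Lemma tens_scalefP a s t : tens_eq s t ->
  tens_eq (map (tens_scalef a) s) (map (tens_scalef a) t).
Proof.
apply: tens_eq_map => *; rewrite /tens_scalef /= ?scalerDr ?scaler0.
- exact: tens_addl.
- exact: tens_addr.
- by rewrite scalerA mulrC -scalerA; apply: tens_scale.
- exact: tens_zero.
Qed.

Definition tzero : tensor := tcls [::].
Definition tadd (t u : tensor) : tensor := tcls (trep t ++ trep u).
Definition tscale (a : F) (t : tensor) : tensor :=
  tcls (map (tens_scalef a) (trep t)).
Definition topp (t : tensor) : tensor := tscale (-1) t.

Lemma tadd_cls s t : tadd (tcls s) (tcls t) = tcls (s ++ t).
Proof. by apply/tcls_eq; apply: tens_cat; apply: trep_cls. Qed.

Lemma tscale_cls a s : tscale a (tcls s) = tcls (map (tens_scalef a) s).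
Proof. by apply/tcls_eq/tens_scalefP/trep_cls. Qed.

Lemma taddA : associative tadd.
Proof.
move=> t u v; rewrite -(trepK t) -(trepK u) -(trepK v).
by rewrite !tadd_cls catA.
Qed.

Lemma taddC : commutative tadd.
Proof. by move=> t u; apply/tcls_eq/tens_comm. Qed.

Lemma tadd0 : left_id tzero tadd.
Proof. by move=> t; rewrite -(trepK t) tadd_cls. Qed.

Lemma tscaleDr a t u : tscale a (tadd t u) = tadd (tscale a t) (tscale a u).
Proof.
rewrite -(trepK t) -(trepK u).
by rewrite !(tadd_cls, tscale_cls) map_cat.
Qed.

Lemma tscaleDl t a b : tscale (a + b) t = tadd (tscale a t) (tscale b t).
Proof.
rewrite -(trepK t); elim: (trep t) => [|[v w] s IHs].
  by rewrite !tscale_cls tadd_cls.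
rewrite -cat1s -tadd_cls.
rewrite !tscaleDr IHs.
have -> : tscale (a + b) (tcls [:: (v, w)]) =
    tadd (tscale a (tcls [:: (v, w)])) (tscale b (tcls [:: (v, w)])).
  rewrite !tscale_cls tadd_cls; apply/tcls_eq.
  by rewrite /= /tens_scalef /= scalerDl; apply: tens_addl.
rewrite -!taddA; congr tadd; rewrite !taddA; congr tadd; exact: taddC.
Qed.

Lemma tscale1 : left_id 1 tscale.
Proof.
move=> t; rewrite -{1}(trepK t) tscale_cls -[RHS]trepK; congr tcls.
by rewrite -[RHS]map_id; apply: eq_map => -[v w]; rewrite /tens_scalef scale1r.
Qed.

Lemma tscale0 t : tscale 0 t = tzero.
Proof.
rewrite -(trepK t) tscale_cls; apply/tcls_eq.
elim: (trep t) => [|[v w] s IHs] /=; first exact: tens_refl.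
rewrite -cat1s -[[::]]/([::] ++ [::]); apply: tens_cat => //.
by rewrite /tens_scalef scale0r; apply: tens_zero.
Qed.

Lemma taddN : left_inverse tzero topp tadd.
Proof.
by move=> t; rewrite -{2}[t]tscale1 /topp -tscaleDl addNr tscale0.
Qed.

HB.instance Definition _ := GRing.isZmodule.Build tensor taddA taddC tadd0 taddN.

Lemma tscaleA a b t : tscale a (tscale b t) = tscale (a * b) t.
Proof.
rewrite -(trepK t) !tscale_cls -map_comp; congr tcls.
by apply: eq_map => -[v w]; rewrite /tens_scalef /= scalerA.
Qed.

HB.instance Definition _ := GRing.Zmodule_isLmodule.Build F tensor
  tscaleA tscale1 tscaleDr tscaleDl.

Lemma tcls_cat s t : tcls (s ++ t) = tcls s + tcls t.
Proof. exact/esym/tadd_cls. Qed.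

Lemma tcls_scale a s : tcls (map (tens_scalef a) s) = a *: tcls s.
Proof. exact/esym/tscale_cls. Qed.

Definition pure (v : V) (w : W) : tensor := tcls [:: (v, w)].

Lemma pureDl v v' w : pure (v + v') w = pure v w + pure v' w.
Proof.
by rewrite -tcls_cat; apply/tcls_eq/tens_addl.
Qed.

Lemma pureDr v w w' : pure v (w + w') = pure v w + pure v w'.
Proof.
by rewrite -tcls_cat; apply/tcls_eq/tens_addr.
Qed.

Lemma pureZl a v w : pure (a *: v) w = a *: pure v w.
Proof. by rewrite -tcls_scale. Qed.

Lemma pureZr a v w : pure v (a *: w) = a *: pure v w.
Proof. by rewrite -pureZl; apply/esym/tcls_eq/tens_scale. Qed.

Lemma pure_bilinear : bilinear_for
  (GRing.Scale.Law.clone _ _ *:%R _) (GRing.Scale.Law.clone _ _ *:%R _) pure.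
Proof.
by split=> ? a u v; rewrite /= ?pureDl ?pureDr ?pureZl ?pureZr.
Qed.

HB.instance Definition _ := bilinear_isBilinear.Build F V W tensor *:%R *:%R
  pure pure_bilinear.

Lemma pure_linear v : linear (pure v).
Proof. by move=> a w w'; rewrite pureDr pureZr. Qed.

HB.instance Definition _ v := GRing.isLinear.Build F W tensor *:%R (pure v)
  (pure_linear v).

Lemma tensorE t : t = \sum_(p <- trep t) pure p.1 p.2.
Proof.
rewrite -{1}(trepK t); elim: (trep t) => [|[v w] s IHs]; rewrite ?big_nil //.
by rewrite big_cons -IHs -cat1s tcls_cat.
Qed.

Lemma tensor_ind (P : tensor -> Prop) :
  P 0 -> (forall v w, P (pure v w)) ->
  (forall t u, P t -> P u -> P (t + u)) -> forall t, P t.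
Proof.
by move=> P0 Pp PD t; rewrite (tensorE t); apply: big_ind => // *; apply: Pp.
Qed.

Section Lift.
Variables (U : lmodType F) (f : {bilinear V -> W -> U}).

Definition tlift (t : tensor) : U := \sum_(p <- trep t) f p.1 p.2.

Lemma tens_eq_sum s t : tens_eq s t ->
  \sum_(p <- s) f p.1 p.2 = \sum_(p <- t) f p.1 p.2.
Proof.
elim=> {s t} //.
- by move=> s t u _ -> _ ->.
- by move=> s s' t t' _ ss' _ tt'; rewrite !big_cat ss' tt'.
- by move=> s t; rewrite !big_cat /= addrC.
- by move=> v v' w; rewrite !big_cons !big_nil /= linearDl !addr0.
- by move=> v w w'; rewrite !big_cons !big_nil /= linearDr !addr0.
- by move=> a v w; rewrite !big_cons !big_nil /= linearZl_LR linearZr_LR.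
- by move=> w; rewrite big_cons !big_nil /= linear0l addr0.
Qed.

Lemma tlift_cls s : tlift (tcls s) = \sum_(p <- s) f p.1 p.2.
Proof. exact/tens_eq_sum/trep_cls. Qed.

Lemma tlift_is_linear : linear tlift.
Proof.
move=> a t u; rewrite -(trepK t) -(trepK u).
rewrite -tcls_scale -tcls_cat !tlift_cls.
rewrite big_cat big_map scaler_sumr; congr (_ + _).
by apply: eq_bigr => -[v w] _; rewrite /= linearZl_LR.
Qed.

HB.instance Definition _ := GRing.isLinear.Build F tensor U *:%R tlift
  tlift_is_linear.

Lemma tlift_pure v w : tlift (pure v w) = f v w.
Proof. by rewrite tlift_cls big_seq1. Qed.

End Lift.

Lemma tensor_ext (U : lmodType F) (g h : {linear tensor -> U}) :
  (forall v w, g (pure v w) = h (pure v w)) -> g =1 h.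
Proof.
move=> gh t; rewrite (tensorE t) !linear_sum.
by apply: eq_bigr => p _; apply: gh.
Qed.

End Tensor.

Arguments pure {F V W}.

Section TensorMaps.
Variable F : fieldType.
Implicit Types V W M : lmodType F.

Section Map.
Variables (V W V' W' : lmodType F).
Variables (f : {linear V -> V'}) (g : {linear W -> W'}).

Definition tmap_fun (v : V) (w : W) : tensor V' W' := pure (f v) (g w).

Lemma tmap_bilinear : bilinear_for
  (GRing.Scale.Law.clone _ _ *:%R _) (GRing.Scale.Law.clone _ _ *:%R _)
  tmap_fun.
Proof.
split=> ? a u v; rewrite /tmap_fun /= linearP.
  by rewrite linearPl.
by rewrite linearPr.
Qed.

HB.instance Definition _ := bilinear_isBilinear.Build F V W _ *:%R *:%R
  tmap_fun tmap_bilinear.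

Definition tmap : {linear tensor V W -> tensor V' W'} := tlift tmap_fun.

Lemma tmap_pure v w : tmap (pure v w) = pure (f v) (g w).
Proof. exact: tlift_pure. Qed.
End Map.

Section Swap.
Variables (V W : lmodType F).

Definition tswap_fun (v : V) (w : W) : tensor W V := pure w v.

Lemma tswap_bilinear : bilinear_for
  (GRing.Scale.Law.clone _ _ *:%R _) (GRing.Scale.Law.clone _ _ *:%R _)
  tswap_fun.
Proof.
by split=> ? a u v; rewrite /tswap_fun /= ?linearPl ?linearPr.
Qed.

HB.instance Definition _ := bilinear_isBilinear.Build F V W _ *:%R *:%R
  tswap_fun tswap_bilinear.

Definition tswap : {linear tensor V W -> tensor W V} := tlift tswap_fun.

Lemma tswap_pure v w : tswap (pure v w) = pure w v.
Proof. exact: tlift_pure. Qed.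
End Swap.

Section Assoc.
Variables (U V W : lmodType F).

Definition tassoc_fun (t : tensor U V) (w : W) : tensor U (tensor V W) :=
  tmap idfun (applyr pure w) t.

Lemma tassoc_bilinear : bilinear_for
  (GRing.Scale.Law.clone _ _ *:%R _) (GRing.Scale.Law.clone _ _ *:%R _)
  tassoc_fun.
Proof.
split=> [w | t] a x y; rewrite /tassoc_fun /= ?linearP //.
elim/tensor_ind: t => [|v w|t t' IHt IHt'].
- by rewrite !linear0 /= ?scaler0 ?addr0.
- by rewrite !tlift_pure /= /tmap_fun /= /applyr !(pureDr, pureZr).
- by rewrite !raddfD /= IHt IHt' addrACA.
Qed.

HB.instance Definition _ := bilinear_isBilinear.Build F _ W _ *:%R *:%R
  tassoc_fun tassoc_bilinear.

(* the canonical isomorphism (U ⊗ V) ⊗ W -> U ⊗ (V ⊗ W) and its inverse *)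
Definition tassoc : {linear tensor (tensor U V) W -> tensor U (tensor V W)} :=
  tlift tassoc_fun.

Lemma tassoc_pure u v w : tassoc (pure (pure u v) w) = pure u (pure v w).
Proof. by rewrite [LHS]tlift_pure [LHS]tmap_pure. Qed.

Definition tassocV_fun (u : U) (t : tensor V W) : tensor (tensor U V) W :=
  tmap (pure u) idfun t.

Lemma tassocV_bilinear : bilinear_for
  (GRing.Scale.Law.clone _ _ *:%R _) (GRing.Scale.Law.clone _ _ *:%R _)
  tassocV_fun.
Proof.
split=> [t | u] a x y; rewrite /tassocV_fun /= ?linearP //.
elim/tensor_ind: t => [|v w|t t' IHt IHt'].
- by rewrite !linear0 /= ?scaler0 ?addr0.
- by rewrite !tlift_pure /= /tmap_fun /= !(pureDl, pureZl).
- by rewrite !raddfD /= IHt IHt' addrACA.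
Qed.

HB.instance Definition _ := bilinear_isBilinear.Build F U _ _ *:%R *:%R
  tassocV_fun tassocV_bilinear.

Definition tassocV : {linear tensor U (tensor V W) -> tensor (tensor U V) W} :=
  tlift tassocV_fun.

Lemma tassocV_pure u v w : tassocV (pure u (pure v w)) = pure (pure u v) w.
Proof. by rewrite [LHS]tlift_pure [LHS]tmap_pure. Qed.
End Assoc.

Section Contract.
Variables (V W : lmodType F).

Section Left.
Variable c : {linear V -> F^o}.
Definition contractl_fun (v : V) (w : W) : W := (c v : F) *: w.

Lemma contractl_bilinear : bilinear_for
  (GRing.Scale.Law.clone _ _ *:%R _) (GRing.Scale.Law.clone _ _ *:%R _)
  contractl_fun.
Proof.
split=> ? a u v; rewrite /contractl_fun /= ?linearP //=.
by rewrite scalerDl -scalerA.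
Qed.

HB.instance Definition _ := bilinear_isBilinear.Build F V W _ *:%R *:%R
  contractl_fun contractl_bilinear.

(* c ⊗ Id : V ⊗ W -> F ⊗ W = W *)
Definition contractl : {linear tensor V W -> W} := tlift contractl_fun.
End Left.

Section Right.
Variable c : {linear W -> F^o}.
Definition contractr_fun (v : V) (w : W) : V := (c w : F) *: v.

Lemma contractr_bilinear : bilinear_for
  (GRing.Scale.Law.clone _ _ *:%R _) (GRing.Scale.Law.clone _ _ *:%R _)
  contractr_fun.
Proof.
split=> ? a u v; rewrite /contractr_fun /= ?linearP //=.
by rewrite scalerDl -scalerA.
Qed.

HB.instance Definition _ := bilinear_isBilinear.Build F V W _ *:%R *:%R
  contractr_fun contractr_bilinear.

(* Id ⊗ c : V ⊗ W -> V ⊗ F = V *)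
Definition contractr : {linear tensor V W -> V} := tlift contractr_fun.
End Right.
End Contract.

(* T ⊗ Id_M on V ⊗ (V ⊗ M) *)
Definition tswap12 V M : {linear tensor V (tensor V M) -> tensor V (tensor V M)}
  := tassoc V V M \o tmap (tswap V V) (idfun : M -> M) \o tassocV V V M.

End TensorMaps.

Section Grading.
Variables (F : fieldType).

Definition subspace (W : lmodType F) (S : set W) : Prop :=
  S 0 /\ forall (a : F) u v, S u -> S v -> S (a *: u + v).

Definition span (W : lmodType F) (S : set W) : set W :=
  [set w | exists2 s : seq (F * W), (forall p, p \in s -> S p.2)
           & w = \sum_(p <- s) p.1 *: p.2].

Record graded_space (I : eqType) (W : lmodType F) (gr : I -> set W) : Prop := {
  graded_subspace : forall i, subspace (gr i);
  graded_generate : forall w : W, exists (s : seq I) (f : I -> W),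
    [/\ uniq s, forall i, i \in s -> gr i (f i) & w = \sum_(i <- s) f i];
  graded_direct : forall (s : seq I) (f : I -> W), uniq s ->
    (forall i, i \in s -> gr i (f i)) -> \sum_(i <- s) f i = 0 ->
    forall i, i \in s -> f i = 0
}.

Definition lower_truncated (I : numDomainType) (W : lmodType F)
    (gr : I -> set W) : Prop :=
  exists N : I, forall k : I, k < N -> forall w, gr k w -> w = 0.

(* [add] is the addition of weights; it is a parameter because the two
   factors may be graded by different groups.                               *)
Definition tensor_grading (I J K : Type) (add : I -> J -> K)
    (V W : lmodType F) (gV : I -> set V) (gW : J -> set W)
    (k : K) : set (tensor V W) :=
  span [set t | exists i j v w,
         [/\ add i j = k, gV i v, gW j w & t = pure v w]].

Definition addzq (i : int) (j : rat) : rat := i%:~R + j.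

(* An element of the direct sum of the Hom(W_(k), F) is identified with the
   functional on W it induces through the natural pairing.                  *)
Definition graded_dual (I : eqType) (W : lmodType F) (gr : I -> set W) :
    set {linear W -> F^o} :=
  [set f | exists s : seq I, forall k, k \notin s -> forall w, gr k w -> f w = 0].

End Grading.

(* W[[x, x^-1]]: [f n] is the coefficient of x^n.  Series in (x0, x2) and
   (x0, x1, x2) are functions on int * int and int * int * int.             *)
Notation fseries W := (int -> W).

Section Series.
Variable F : fieldType.

Definition scoef (W : lmodType F) (n : int) (f : fseries W) : W := f n.

Lemma scoef_is_linear (W : lmodType F) n : linear (@scoef W n).
Proof. by []. Qed.

HB.instance Definition _ (W : lmodType F) n :=
  GRing.isLinear.Build F (fseries W) W *:%R (@scoef W n) (@scoef_is_linear W n).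

(* the n-th coefficient of a linear map Y(x) : V -> W[[x, x^-1]] *)
Definition ycoef (V W : lmodType F) (Y : {linear V -> fseries W}) (n : int) :
  {linear V -> W} := @scoef W n \o Y.

(* Delta_k, where Y(x) v = \sum_k Delta_k(v) x^(-k-1) *)
Definition Delta (V W : lmodType F) (Y : {linear V -> fseries W}) (k : int)
  (v : V) : W := Y v (- k - 1).

(* f lies in W((x^-1)) *)
Definition upper_truncated (W : lmodType F) (f : fseries W) : Prop :=
  exists N : int, forall n : int, N < n -> f n = 0.

(* n (n - 1) ... (n - m + 1) / m! *)
Definition binz (n : int) (m : nat) : F :=
  (\prod_(i < m) (n - i%:Z)%:~R) / (m`!)%:R.

(* coefficient of x^a y^b in (x + s y)^n, expanded in nonnegative powers of
   the second variable y                                                    *)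
Definition binpow (s : F) (n a b : int) : F :=
  if b is Posz m then (if a + b == n then binz n m * s ^+ m else 0) else 0.

(* Product of a scalar series with a vector-valued one, with exponents in I.
   The sum is finitary, with value 0 on infinite supports.  In every use
   below the support is finite: p involves nonnegative powers of its second
   variable only, and the truncation axiom bounds above the powers in the inner
   coaction.                                                                *)
Definition smul (I : zmodType) (W : lmodType F) (p : I -> F) (g : I -> W) :
    I -> W :=
  fun e => \sum_(i \in [set: I]) p i *: g (e - i).

(* Delta series, with exponents in the order (x0, x1, x2).  For instance the
   first one is \sum_n x0^(-n-1) (x1 - x2)^n, where only n = -a-1
   contributes to x0^a.                                                     *)

(* x0^-1 delta((x1 - x2) / x0) *)
Definition delta_12_0 (e : int * int * int) : F :=
  let: (a, b, c) := e in binpow (-1) (- a - 1) b c.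

(* x0^-1 delta((x2 - x1) / (- x0)) *)
Definition delta_21_0 (e : int * int * int) : F :=
  let: (a, b, c) := e in (-1) ^ (- a - 1) * binpow (-1) (- a - 1) c b.

(* x2^-1 delta((x1 - x0) / x2) *)
Definition delta_10_2 (e : int * int * int) : F :=
  let: (a, b, c) := e in binpow (-1) (- c - 1) b a.

(* f(x0 + x2) *)
Definition subst_add (W : lmodType F) (f : fseries W) : int * int -> W :=
  fun e => \sum_(n \in [set: int]) binpow 1 n e.1 e.2 *: f n.

Section Coaction.
Variables (V M : lmodType F).
Variables (YV : {linear V -> fseries (tensor V V)}).
Variables (YM : {linear M -> fseries (tensor V M)}).

(* coefficient of x^p y^q in (Id_V ⊗ Y_M(x)) Y_M(y) w *)
Definition coact_right (w : M) (p q : int) : tensor V (tensor V M) :=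
  tmap idfun (ycoef YM p) (YM w q).

(* coefficient of x^p y^q in (Y_V(x) ⊗ Id_M) Y_M(y) w *)
Definition coact_left (w : M) (p q : int) : tensor V (tensor V M) :=
  tassoc V V M (tmap (ycoef YV p) idfun (YM w q)).

Definition jacobi_identity : Prop := forall w : M,
  smul delta_12_0
    (fun '(a, b, c) => if a == 0 then coact_right w c b else 0)
  \- smul delta_21_0
    (fun '(a, b, c) => if a == 0 then tswap12 V M (coact_right w b c) else 0)
  = smul delta_10_2
    (fun '(a, b, c) => if b == 0 then coact_left w a c else 0).

(* (Y_V(x0) ⊗ Id_M) Y_M(x2) w, with exponents in the order (x0, x2) *)
Definition coassoc_left (w : M) : int * int -> tensor V (tensor V M) :=
  fun e => coact_left w e.1 e.2.

(* (Id_V ⊗ Y_M(x2)) Y_M(x0 + x2) w: a power x2^j coming from x0 + x2 leaves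
   the coefficient of x2^(e.2 - j) to Y_M(x2)                               *)
Definition coassoc_right (w : M) : int * int -> tensor V (tensor V M) :=
  fun e => \sum_(j \in [set: int])
    tmap idfun (ycoef YM (e.2 - j)) (subst_add (YM w) (e.1, j)).

Definition weak_coassociativity
    (dual : set {linear tensor V (tensor V M) -> F^o}) : Prop :=
  forall v', dual v' -> exists2 k : nat, (0 < k)%N & forall w : M,
    smul (W := F^o) (fun e : int * int => binpow 1 k%:Z e.1 e.2)
      (fun e => v' (coassoc_left w e - coassoc_right w e)) = 0.

End Coaction.

(* (c ⊗ Id) Y(x) w = w as a series: w is the constant term *)
Definition left_counit (V M : lmodType F) (c : {linear V -> F^o})
    (YM : {linear M -> fseries (tensor V M)}) : Prop :=
  forall (w : M) (n : int),
    contractl M c (YM w n) = if n == 0 then w else 0.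

Record vertex_coalgebra (V : lmodType F)
    (Y : {linear V -> fseries (tensor V V)}) (c : {linear V -> F^o}) : Prop := {
  vc_counit : left_counit c Y;
  vc_cocreation : forall v : V,
    (forall n : int, n < 0 -> contractr V c (Y v n) = 0)
    /\ contractr V c (Y v 0) = v;
  vc_truncation : forall v : V, upper_truncated (Y v);
  vc_jacobi : jacobi_identity Y Y
}.

Record graded_vertex_coalgebra (V : lmodType F)
    (Y : {linear V -> fseries (tensor V V)}) (c : {linear V -> F^o})
    (gV : int -> set V) : Prop := {
  gvc_coalgebra : vertex_coalgebra Y c;
  gvc_graded : graded_space gV;
  gvc_lower : lower_truncated gV;
  gvc_weight : forall (r k : int) (v : V), gV r v ->
    tensor_grading +%R gV gV (r + k + 1) (Delta Y k v)
}.

Record comodule_without_jacobi (V : lmodType F) (c : {linear V -> F^o})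
    (gV : int -> set V) (M : lmodType F)
    (YM : {linear M -> fseries (tensor V M)}) (gM : rat -> set M) : Prop := {
  com_graded : graded_space gM;
  com_lower : lower_truncated gM;
  com_weight : forall (j : rat) (k : int) (w : M), gM j w ->
    tensor_grading addzq gV gM (j + k%:~R + 1) (Delta YM k w);
  com_counit : left_counit c YM;
  com_truncation : forall w : M, upper_truncated (YM w)
}.

(* (V ⊗ V ⊗ M)' *)
Definition triple_dual (V M : lmodType F) (gV : int -> set V)
    (gM : rat -> set M) : set {linear tensor V (tensor V M) -> F^o} :=
  graded_dual (tensor_grading addzq gV (tensor_grading addzq gV gM)).

End Series.

(* Main.v *)
From HB Require Import structures.
Require Import Defs.
From mathcomp Require Import all_boot all_order all_algebra.
From mathcomp Require Import boolp classical_sets functions fsbigop.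
From mathcomp Require Import sesquilinear zify ring lra.
Import Order.TTheory Num.Theory.
Import GRing.Theory.
Local Open Scope ring_scope.

(** Let J be the difference of the two sides of the Jacobi identity, as a
    series in x0, x1, x2 with coefficients in V ⊗ V ⊗ M.  All three delta
    series are killed by x1 - x2 - x0, hence so is J: this is Pascal's rule
    for binomial coefficients ([jacobiator_rel]).  A series killed by
    x1 - x2 - x0 in which the exponents of x1 and of x2 are bounded below is
    zero ([delta_rel_eq0]).  It therefore suffices to bound these exponents
    in f(J) for every f in the graded dual of V ⊗ V ⊗ M, because such
    functionals separate points ([graded_dual_sep]).

    Bounding the exponents of x1.  Taking the residue in x1 of x1^k J, for
    large k, leaves (x0 + x2)^k times the difference of the two sides of
    coassociativity: the middle term of J does not contribute, because the
    grading bounds the powers of x1 below in f of that term, uniformly in w.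
    So weak coassociativity says exactly that f(J) has no low powers of x1
    ([jacobiator_low_x1]).

    Bounding the exponents of x2.  The transposition of the two factors V,
    together with x1 <-> x2 and x0 -> -x0, exchanges the first two terms of J
    and, for the powers of x2 that matter, fixes the third one
    ([jacobiator_swap]); so the previous bound applied to f after the
    transposition gives the new one.  That the iterate term has this symmetry
    rests on two facts.  The first is skew-symmetry in V,
    T Y_V(x) = Y_V(-x) exp(x D), where exp(x D) = (Id ⊗ c) Y_V(x); it is one
    coefficient of the Jacobi identity of V contracted with the counit
    ([skew_symmetry]).  The second is (exp(x0 D) ⊗ Id) Y_M(x2) = Y_M(x2 + x0);
    it comes from weak coassociativity contracted with c in the middle factor,
    after cancelling (x0 + x2)^k ([translation]). *)

Set Implicit Arguments.
Unset Strict Implicit.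
Unset Printing Implicit Defensive.

(** * Binomial coefficients and formal sums *)

Section Binomials.
Variable F : fieldType.

Lemma binz0 (n : int) : binz F n 0 = 1.
Proof. by rewrite /binz big_ord0 fact0 divr1. Qed.

(** Both sides are the coefficient of y^m in (1 - y)^(-n-1). *)
Lemma binz_neg (n : int) (m : nat) :
  (-1) ^+ m * binz F (- n - 1) m = binz F (n + m%:Z) m.
Proof.
rewrite /binz mulrA; congr (_ / _).
rewrite [in RHS](reindex_inj rev_ord_inj).
rewrite -[in (-1) ^+ m](card_ord m) -prodr_const.
rewrite -big_split /=; apply: eq_bigr => i _.
rewrite mulN1r -mulrNz; congr (_%:~R).
by have := ltn_ord i; rewrite /=; lia.
Qed.

Hypothesis F0 : [pchar F] =i pred0.

Lemma binzS (n : int) (m : nat) :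
  binz F (n + 1) m.+1 = binz F n m.+1 + binz F n m.
Proof.
have nz k : (k.+1)%:R != 0 :> F by rewrite (pcharf0P F).1.
have fz k : (k`!)%:R != 0 :> F by rewrite (pcharf0P F).1 // -lt0n fact_gt0.
rewrite /binz big_ord_recl [X in _ = X / _ + _]big_ord_recr /=.
rewrite (eq_bigr (fun i : 'I_m => (n - i%:Z)%:~R)); last first.
  by move=> i _; congr (_%:~R); rewrite /bump /=; lia.
rewrite factS natrM; set P := \prod_(i < m) _.
have -> : (n + 1 - 0%:Z)%:~R = n%:~R + 1 :> F by rewrite subr0 rmorphD.
have -> : (n - m%:Z)%:~R = n%:~R - m%:R :> F by rewrite rmorphB /=.
have := nz m; rewrite -natr1 => nzm; have fzm := fz m.
by field; rewrite fzm nzm.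
Qed.

Lemma binz_nat (n m : nat) : binz F n%:Z m = 'C(n, m)%:R.
Proof.
elim: n m => [|n IHn] [|m]; rewrite ?binz0 ?bin0 //.
  by rewrite /binz big_ord_recl /= subrr mulr0z mul0r mul0r.
by rewrite binS -addn1 PoszD binzS !IHn natrD.
Qed.

End Binomials.

Section NatSums.
Local Open Scope classical_set_scope.

Lemma fsum_nat (W : zmodType) (g : nat -> W) (N : nat) :
  (forall m, (N <= m)%N -> g m = 0) ->
  \sum_(m \in [set: nat]) g m = \sum_(m < N) g m.
Proof.
move=> g0; rewrite fsbig_ord; apply/esym/fsbig_widen => // m [_] /= /negP.
by rewrite -leqNgt => /g0.
Qed.

Lemma fsum_inj (W : zmodType) (I : choiceType) (phi : nat -> I) (h : I -> W) :
  injective phi -> (forall i, (forall m, i <> phi m) -> h i = 0) ->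
  \sum_(i \in [set: I]) h i = \sum_(m \in [set: nat]) h (phi m).
Proof.
move=> phi_inj h0; transitivity (\sum_(i \in phi @` setT) h i).
  apply/esym/fsbig_widen => // i [_] ni; apply: h0 => m im; apply: ni.
  by exists m.
by apply: fsbig_image => x y _ _ /phi_inj.
Qed.

End NatSums.

Section NegativeBinomials.
Local Open Scope classical_set_scope.
Variables (F : fieldType) (W : lmodType F).
Implicit Types (G : int -> int -> W) (s : F).

(** The coefficient of x^p y^q in (1 - s x/y)^(-n-1) G(x, y): up to
    monomials and signs, each delta series of the Jacobi identity acts in this
    way. *)
Definition negbin_mul s (n : int) G (p q : int) : W :=
  \sum_(m \in [set: nat])
    (s ^+ m * binz F (n + m%:Z) m) *: G (p - m%:Z) (q + m%:Z).

Definition bounded_above G : Prop :=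
  exists B : int, forall p q, B < q -> G p q = 0.

Lemma negbin_mulE s n G p q (N : nat) :
  (forall m, (N <= m)%N -> G (p - m%:Z) (q + m%:Z) = 0) ->
  negbin_mul s n G p q = \sum_(m < N)
    (s ^+ m * binz F (n + m%:Z) m) *: G (p - m%:Z) (q + m%:Z).
Proof. by move=> G0; apply: fsum_nat => m /G0 ->; rewrite scaler0. Qed.

(** The sum over all of nat is finitary, so every manipulation goes through a
    truncation to finitely many terms. *)
Lemma negbin_mul_cut s n G : bounded_above G -> forall p q,
  exists N0, forall N : nat, (N0 <= N)%N -> negbin_mul s n G p q = \sum_(m < N)
    (s ^+ m * binz F (n + m%:Z) m) *: G (p - m%:Z) (q + m%:Z).
Proof.
case=> B GB p q; exists `|B - q|.+1%N => N leN; apply: negbin_mulE => m leNm.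
by apply: GB; lia.
Qed.

Lemma negbin_mul_eq s n G p q :
  (forall m : nat, (0 < m)%N -> G (p - m%:Z) (q + m%:Z) = 0) ->
  negbin_mul s n G p q = G p q.
Proof.
by move=> /negbin_mulE ->; rewrite big_ord1 binz0 mulr1 scale1r subr0 addr0.
Qed.

Lemma eq_negbin_mul s n G G' : (forall p q, G p q = G' p q) ->
  forall p q, negbin_mul s n G p q = negbin_mul s n G' p q.
Proof. by move=> eqG p q; apply: eq_fsbigr => m _; rewrite eqG. Qed.

Hypothesis F0 : [pchar F] =i pred0.

Lemma negbin_mulN1 s G p q : negbin_mul s (- 1) G p q = G p q.
Proof.
rewrite /negbin_mul (@fsum_nat _ _ 1); last first.
  case=> // m _; have -> : - 1 + m.+1%:Z = m%:Z by lia.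
  by rewrite binz_nat // bin_small // mulr0 scale0r.
by rewrite big_ord1 binz0 mulr1 scale1r subr0 addr0.
Qed.

(** (1 - s x/y)^(-n) = (1 - s x/y) (1 - s x/y)^(-n-1). *)
Lemma negbin_mul_pascal s n G : bounded_above G -> forall p q,
  negbin_mul s (n - 1) G p q =
  negbin_mul s n G p q - s *: negbin_mul s n G (p - 1) (q + 1).
Proof.
move=> GB p q.
have [N1 e1] := negbin_mul_cut s (n - 1) GB p q.
have [N2 e2] := negbin_mul_cut s n GB p q.
have [N3 e3] := negbin_mul_cut s n GB (p - 1) (q + 1).
pose N := (N1 + N2 + N3)%N.
rewrite (e1 N.+1) ?(e2 N.+1) ?(e3 N); try by rewrite /N; lia.
rewrite !big_ord_recl /= !binz0 -addrA; congr (_ + _).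
rewrite scaler_sumr -sumrB; apply: eq_bigr => i _ /=.
rewrite scalerA /bump /= add1n mulrA -exprS.
have -> : p - 1 - i%:Z = p - i.+1%:Z by lia.
have -> : q + 1 + i%:Z = q + i.+1%:Z by lia.
rewrite -scalerBl; congr (_ *: _); rewrite -mulrBr; congr (_ * _).
have -> : n + i.+1%:Z = n + i%:Z + 1 by lia.
have -> : n - 1 + i.+1%:Z = n + i%:Z by lia.
by rewrite binzS // addrK.
Qed.

End NegativeBinomials.

Lemma linear_negbin_mul (F : fieldType) (W W' : lmodType F)
    (f : {linear W -> W'}) (s : F) n G : bounded_above G -> forall p q,
  f (negbin_mul s n G p q) = negbin_mul s n (fun p q => f (G p q)) p q.
Proof.
move=> GB p q; case: (GB) => B GB'.
have [N e1] := negbin_mul_cut s n GB p q.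
have [|N' e2] := @negbin_mul_cut _ _ s n (fun p q => f (G p q)) _ p q.
  by exists B => p' q' /GB' ->; rewrite linear0.
rewrite (e1 (N + N')%N) ?leq_addr // (e2 (N + N')%N) ?leq_addl // linear_sum.
by apply: eq_bigr => i _; rewrite linearZ.
Qed.

Section Shift.
Variables (F : fieldType) (W : lmodType F).
Implicit Types G : int -> int -> W.

(** Multiplication by x0 + x2, on coefficients of x0^a x2^c. *)
Definition add_mul G (a c : int) : W := G (a - 1) c + G a (c - 1).

Lemma iter_add_mul k G a c : iter k add_mul G a c =
  \sum_(m < k.+1) 'C(k, m)%:R *: G (a - (k%:Z - m%:Z)) (c - m%:Z).
Proof.
elim: k a c => [|k IHk] a c; first by rewrite big_ord1 bin0 scale1r !subr0.
rewrite /= /add_mul !IHk.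
pose H (m : nat) := G (a - (k.+1%:Z - m%:Z)) (c - m%:Z).
transitivity (\sum_(m < k.+1) 'C(k, m)%:R *: H m
  + \sum_(m < k.+1) 'C(k, m)%:R *: H m.+1).
  by congr (_ + _); apply: eq_bigr => m _; congr (_ *: G _ _); lia.
have -> : \sum_(m < k.+1) 'C(k, m)%:R *: H m =
    \sum_(m < k.+2) 'C(k, m)%:R *: H m.
  by rewrite [RHS]big_ord_recr /= bin_small // scale0r addr0.
rewrite !(big_ord_recl k.+1) !bin0 -addrA; congr (_ + _).
rewrite -big_split; apply: eq_bigr => i _ /=.
by rewrite /bump /= add1n binS natrD scalerDl.
Qed.

Lemma smul_binpow (F0 : [pchar F] =i pred0) k G a c :
  smul (fun e : int * int => binpow 1 k%:Z e.1 e.2) (fun e => G e.1 e.2) (a, c)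
  = iter k add_mul G a c.
Proof.
rewrite iter_add_mul /smul (@fsum_inj _ _ (fun m : nat => (k%:Z - m%:Z, m%:Z))).
- rewrite (@fsum_nat _ _ k.+1) => [|m ltkm]; rewrite /binpow /=; last first.
    by rewrite subrK eqxx binz_nat // bin_small // mul0r scale0r.
  by apply: eq_bigr => m _; rewrite subrK eqxx binz_nat // expr1n mulr1.
- by move=> m m' [].
- case=> x [m|m] nm /=; rewrite ?scale0r //; case: eqP => [e|_]; last first.
    by rewrite scale0r.
  by case: (nm m); congr (_, _); lia.
Qed.

(** x0 + x2 is not a zero divisor among the series in nonnegative powers of
    x0; on all doubly infinite series it is one. *)
Lemma add_mul_cancel G : (forall a c, a < 0 -> G a c = 0) ->
  (forall a c, add_mul G a c = 0) -> forall a c, G a c = 0.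
Proof.
move=> Gneg G0 a c; have [a0|a0] := ltP a 0; first exact: Gneg.
have -> : a = `|a|%N%:Z by lia.
elim: `|a|%N c => [|n IHn] c.
  by have := G0 0 (c + 1); rewrite /add_mul Gneg // add0r addrK.
have := G0 n.+1%:Z (c + 1); rewrite /add_mul addrK.
have -> : n.+1%:Z - 1 = n%:Z by lia.
by rewrite IHn add0r.
Qed.

Lemma iter_add_mul_cancel k G : (forall a c, a < 0 -> G a c = 0) ->
  (forall a c, iter k add_mul G a c = 0) -> forall a c, G a c = 0.
Proof.
elim: k => [|k IHk] // Gneg G0; apply: IHk => //; apply: add_mul_cancel => //.
elim: k {G0} => [|k IHk] // a c a0 /=; rewrite /add_mul !IHk ?addr0 //; lia.
Qed.

(** The relation says that x1 - x2 - x0 kills the series j.  At the lowest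
    power of x1 that may occur in j, it turns into x0 j = - x2 j, which moves
    coefficients to ever lower powers of x2, where they vanish. *)
Lemma delta_rel_eq0 (j : int -> int -> int -> W) (B C : int) :
  (forall a b c, j (a - 1) b c = j a (b - 1) c - j a b (c - 1)) ->
  (forall a b c, b <= B -> j a b c = 0) ->
  (forall a b c, c <= C -> j a b c = 0) -> forall a b c, j a b c = 0.
Proof.
move=> rel jB jC a b c; have [bB|Bb] := leP b B; first exact: jB.
have -> : b = B + `|b - B|%N%:Z by lia.
elim: `|b - B|%N a c => [|n IHn] a c; first by apply: jB; lia.
have step a' c' : j (a' - 1) (B + n.+1%:Z) c' = - j a' (B + n.+1%:Z) (c' - 1).
  rewrite rel; have -> : B + n.+1%:Z - 1 = B + n%:Z by lia.
  by rewrite IHn add0r.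
have [cC|Cc] := leP c C; first exact: jC.
have -> : c = C + `|c - C|%N%:Z by lia.
elim: `|c - C|%N a => [|k IHk] a'; first by apply: jC; lia.
rewrite -[a'](addrK 1) step; have -> : C + k.+1%:Z - 1 = C + k%:Z by lia.
by rewrite IHk oppr0.
Qed.

End Shift.

Lemma iter_add_mulD (F : fieldType) (W : lmodType F)
    (G H : int -> int -> W) k a c :
  iter k (@add_mul F W) (fun a c => G a c + H a c) a c =
  iter k (@add_mul F W) G a c + iter k (@add_mul F W) H a c.
Proof.
by elim: k a c => [|k IHk] a c //=; rewrite /add_mul !IHk addrACA.
Qed.

(** On a series killed by x1 - x2 - x0, lowering the exponent of x1 amounts to
    multiplying by x0 + x2. *)
Lemma iter_add_mul_rel (F : fieldType) (W : lmodType F)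
    (j : int -> int -> int -> W) (B : int) k a c :
  (forall a b c, j (a - 1) b c = j a (b - 1) c - j a b (c - 1)) ->
  j a (B - k%:Z) c = iter k (@add_mul F W) (fun a c => j a B c) a c.
Proof.
move=> rel; elim: k a c => [|k IHk] a c /=; first by rewrite subr0.
rewrite /add_mul -!IHk rel subrK; congr (j _ _ _); lia.
Qed.

Lemma iter_add_mul0 (F : fieldType) (W : lmodType F) (G : int -> int -> W) k :
  (forall a c, G a c = 0) -> forall a c, iter k (@add_mul F W) G a c = 0.
Proof.
by move=> G0; elim: k => [|k IHk] a c //=; rewrite /add_mul !IHk addr0.
Qed.

(** * Functionals on graded spaces *)

Section Functionals.
Local Open Scope classical_set_scope.

Lemma linear_of_fun (R : fieldType) (U V : lmodType R) (f : U -> V) :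
  linear f -> exists g : {linear U -> V}, g =1 f.
Proof.
move=> f_lin; pose m := GRing.isLinear.Build R U V *:%R f f_lin.
pose g : {linear U -> V} := HB.pack f m.
by exists g.
Qed.

Variables (F : fieldType) (W : lmodType F).

(** By Zorn's lemma there is a subspace A maximal among those that avoid w;
    by maximality every vector is congruent to a unique multiple of w
    modulo A, and this coefficient is the functional. *)
Lemma functional_neq0 (w : W) :
  w != 0 -> exists f : {linear W -> F^o}, f w != 0.
Proof.
move=> w0.
pose closed (A : set W) := forall (a : F) u v, A u -> A v -> A (a *: u + v).
pose P (A : set W) := closed A /\ ~ A w.
have [|A [[Acl Aw] Amax]] := @Zorn_bigcup W P.
  move=> C CP Ctot; split=> [a u v [X CX Xu] [Y CY Yv]|[X CX Xw]]; last first.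
    by case: (CP _ CX).
  case: (Ctot _ _ CX CY) => XY; [exists Y => // | exists X => //].
    by apply: (CP _ CY).1 => //; apply: XY.
  by apply: (CP _ CX).1 => //; apply: XY.
have max B : closed B -> A `<=` B -> (exists2 u, B u & ~ A u) -> B w.
  move=> Bcl AB [u Bu nAu]; apply: contrapT => nBw.
  by apply: (Amax B) => //; split=> // /(_ u Bu).
(* otherwise A would be empty, hence smaller than the zero subspace *)
have A0 : A 0.
  apply: contrapT => nA0; apply/(negP w0)/eqP.
  apply: (max [set 0]) => [a u v -> ->|u Au|].
  - by rewrite /= scaler0 addr0.
  - by case: nA0; have := Acl (-1) _ _ Au Au; rewrite scaleN1r addNr.
  - by exists 0.
have AZ a u : A u -> A (a *: u).
  by move=> Au; rewrite -[_ *: _]addr0; apply: Acl.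
have AB u v : A u -> A v -> A (u - v).
  by move=> Au Av; rewrite addrC -scaleN1r; apply: Acl.
have coord u : exists a : F, A (u - a *: w).
  have [Au|nAu] := pselect (A u); first by exists 0; rewrite scale0r subr0.
  (* if u is not in A, then A + F u contains w *)
  have [|v Av|| [a v] Av /= wE] :=
      max [set t | exists2 p : F * W, A p.2 & t = p.1 *: u + p.2].
  - move=> a _ _ [[b v] /= Av ->] [[b' v'] /= Av' ->].
    exists (a * b + b', a *: v + v'); first exact: Acl.
    by rewrite /= scalerDr scalerA addrACA -scalerDl.
  - by exists (0, v); rewrite //= scale0r add0r.
  - exists u => //; exists (1, 0); rewrite //= scale1r addr0 //.
  have a0 : a != 0.
    by apply: contra_notN Aw => /eqP a0; rewrite wE a0 scale0r add0r.
  exists a^-1; rewrite wE scalerDr scalerA mulVf // scale1r opprD addNKr.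
  by rewrite -scaleN1r; do 2!apply: (AZ).
have uniq a b u : A (u - a *: w) -> A (u - b *: w) -> a = b.
  move=> Aa Ab; apply/eqP; rewrite -subr_eq0; apply: contra_notT Aw => ab.
  have := AZ (a - b)^-1 _ (AB _ _ Ab Aa).
  have -> : u - b *: w - (u - a *: w) = (a - b) *: w.
    by rewrite opprB scalerBl addrC addrA subrK.
  by rewrite scalerA mulVf // scale1r.
have [f fP] := choice coord.
have [|g gf] := @linear_of_fun F W F^o f.
  move=> a u v; apply: (uniq _ _ (a *: u + v)) => //.
  rewrite scalerDl opprD addrACA -scalerA -scalerBr.
  by apply: Acl; apply: fP.
exists g; rewrite gf; have -> : f w = 1; last exact: oner_neq0.
by apply: uniq (fP w) _; rewrite scale1r subrr.
Qed.

End Functionals.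

Lemma big_support (W : zmodType) (I : eqType) (h : I -> W) (s t : seq I) :
  uniq s -> uniq t -> {subset s <= t} -> (forall i, i \notin s -> h i = 0) ->
  \sum_(i <- t) h i = \sum_(i <- s) h i.
Proof.
move=> us ut st h0; rewrite (bigID (mem s)) /= [X in _ + X]big1 ?addr0 //.
rewrite -big_filter; apply: perm_big; apply: uniq_perm; rewrite ?filter_uniq //.
by move=> i; rewrite mem_filter; case: (boolP (i \in s)) => // /st ->.
Qed.

Section Projections.
Local Open Scope classical_set_scope.

(** A family of endomorphisms that sums, finitely at each vector, to the
    identity and whose member a lives on the single weight [wt a].  Several
    members may share a weight: on a tensor product this allows one member for
    each pair of weights, without grouping the pairs by their sum. *)
Definition projections (F : fieldType) (W : lmodType F) (K A : eqType)
    (gr : K -> set W) (wt : A -> K) (P : A -> {linear W -> W}) : Prop :=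
  (forall a k w, gr k w -> k != wt a -> P a w = 0) /\
  (forall w, exists s : seq A, [/\ uniq s, forall a, a \notin s -> P a w = 0
     & w = \sum_(a <- s) P a w]).

Variables (F : fieldType).

(** A vector has only one family of homogeneous components, because the sum
    is direct; uniqueness makes the components linear in the vector. *)
Lemma graded_projections (I : eqType) (W : lmodType F) (gr : I -> set W) :
  graded_space gr -> exists P : I -> {linear W -> W},
    projections gr id P.
Proof.
case=> gsub ggen gdir.
have gr0 i : gr i 0 by case: (gsub i).
have grl i := (gsub i).2.
pose dec w (h : I -> W) := (forall i, gr i (h i)) /\ exists s : seq I,
  [/\ uniq s, forall a, a \notin s -> h a = 0 & w = \sum_(a <- s) h a].
have dec_lin a w w' h h' : dec w h -> dec w' h' ->
    dec (a *: w + w') (fun i => a *: h i + h' i).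
  case=> grh [s [us hs wE]] [grh' [s' [us' hs' wE']]].
  split=> [i|]; first exact: grl.
  exists (undup (s ++ s')); split=> [||]; first exact: undup_uniq.
    move=> i; rewrite mem_undup mem_cat negb_or => /andP[/hs -> /hs' ->].
    by rewrite scaler0 addr0.
  rewrite big_split -scaler_sumr /=
      (big_support (t := undup (s ++ s')) us) ?undup_uniq //; last first.
    by move=> i; rewrite mem_undup mem_cat => ->.
  rewrite (big_support (t := undup (s ++ s')) us') ?undup_uniq -?wE -?wE' //.
  by move=> i; rewrite mem_undup mem_cat orbC => ->.
have dec_uniq w h h' : dec w h -> dec w h' -> h = h'.
  move=> dh dh'; have := dec_lin (-1) _ _ _ _ dh dh'.
  rewrite scaleN1r addNr => -[grd [s [us ds sumd]]]; apply/funext => i.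
  have [si|/ds] := boolP (i \in s).
    have := gdir s _ us (fun i _ => grd i) (esym sumd) i si.
    by rewrite scaleN1r addrC => /eqP; rewrite subr_eq0 => /eqP.
  by rewrite scaleN1r addrC => /eqP; rewrite subr_eq0 => /eqP.
have dec_ex w : exists h, dec w h.
  have [s [f [us sf wE]]] := ggen w.
  exists (fun i => if i \in s then f i else 0); split=> [i|].
    by case: ifP => // /sf.
  exists s; split=> // [a /negPf ->|] //.
  by rewrite wE; apply: eq_big_seq => i ->.
have [p pP] := choice dec_ex.
have p_lin i : linear (fun w => p w i).
  move=> a u v.
  by rewrite (dec_uniq _ _ _ (pP _) (dec_lin a _ _ _ _ (pP u) (pP v))).
have [P PE] := choice (fun i => linear_of_fun (p_lin i)).
exists P; split=> [i k w grw nki|w]; last first.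
  case: (pP w) => _ [s [us s0 wE]]; exists s; split=> // [a /s0|].
    by rewrite PE.
  by rewrite {1}wE; apply: eq_bigr => a _; rewrite PE.
rewrite PE (dec_uniq w (p w) (fun i => if i == k then w else 0)) //.
  by rewrite eq_sym (negPf nki).
split=> [j|]; first by case: eqP => [->|].
exists [:: k]; split=> // [a|]; last by rewrite big_seq1 eqxx.
by rewrite inE => /negPf ->.
Qed.

Lemma projections_id (I : eqType) (W : lmodType F) (gr : I -> set W) P i w :
  projections gr id P -> gr i w -> P i w = w.
Proof.
case=> P0 Psum grw; have [s [us s0 wE]] := Psum w.
have Pi j : j != i -> P j w = 0 by rewrite eq_sym => /P0; apply.
have [si|/[dup] nsi /s0 Pi0] := boolP (i \in s).
  by rewrite {2}wE (bigD1_seq i) //= big1 ?addr0 // => j; apply: Pi.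
rewrite Pi0 wE big1_seq // => j /andP[_ sj]; apply: Pi.
by apply: contraNneq nsi => <-.
Qed.

Lemma span_ind (W : lmodType F) (S : set W) (Q : W -> Prop) :
  Q 0 -> (forall a u v, S u -> Q v -> Q (a *: u + v)) ->
  forall w, Defs.span S w -> Q w.
Proof.
move=> Q0 QS _ [s Ss ->]; elim: s Ss => [|p s IHs] Ss; first by rewrite big_nil.
rewrite big_cons; apply: QS; first by apply: Ss; rewrite inE eqxx.
by apply: IHs => q sq; apply: Ss; rewrite inE sq orbT.
Qed.

Lemma span_ker (W U : lmodType F) (S : set W) (f : {linear W -> U}) :
  (forall w, S w -> f w = 0) -> forall w, Defs.span S w -> f w = 0.
Proof.
move=> fS; apply: span_ind => [|a u v Su fv]; first exact: linear0.
by rewrite linearP fS // fv scaler0 addr0.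
Qed.

Lemma tensor_projections (I J K A B : eqType) (V W : lmodType F)
    (add : I -> J -> K) (gV : I -> set V) (gW : J -> set W)
    (wV : A -> I) (wW : B -> J) P Q :
  projections gV wV P -> projections gW wW Q ->
  projections (tensor_grading add gV gW)
    (fun p : A * B => add (wV p.1) (wW p.2)) (fun p => tmap (P p.1) (Q p.2)).
Proof.
case=> P0 Psum [Q0 Qsum]; split=> [[a b] k|].
  move=> t kt /= nk; apply: span_ker t kt => _ [i [j [v [w [ijk vi wj ->]]]]].
  rewrite tmap_pure; have [ia|/(P0 a _ _ vi) ->] := eqVneq i (wV a); last first.
    by rewrite linear0l.
  have [jb|/(Q0 b _ _ wj) ->] := eqVneq j (wW b); last by rewrite linear0r.
  by rewrite -ijk ia jb eqxx in nk.
apply: tensor_ind => [|v w|t u [s [us s0 tE]] [s' [us' s0' uE]]].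
- by exists [::]; split=> // [a _|]; rewrite ?big_nil // linear0.
- have [s [us s0 vE]] := Psum v; have [s' [us' s0' wE]] := Qsum w.
  exists (allpairs pair s s'); split.
  + by apply: allpairs_uniq => // -[? ?] [? ?] _ _ [-> ->].
  + move=> [a b] nab; rewrite tmap_pure /=.
    have [sa|/s0 ->] := boolP (a \in s); last by rewrite linear0l.
    have [sb|/s0' ->] := boolP (b \in s'); last by rewrite linear0r.
    by case/negP: nab; apply/allpairsP; exists (a, b).
  + rewrite big_allpairs_dep /= {1}vE linear_sumlz; apply: eq_bigr => a _.
    rewrite {1}wE linear_sumr; apply: eq_bigr => b _.
    by rewrite tmap_pure.
- exists (undup (s ++ s')); split.
  + exact: undup_uniq.
  + move=> a; rewrite mem_undup mem_cat negb_or => /andP[/s0 e /s0' e'].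
    by rewrite raddfD /= e e' addr0.
  + under eq_bigr do rewrite raddfD.
    rewrite big_split /=
      (big_support (t := undup (s ++ s')) us) ?undup_uniq //; last first.
      by move=> i; rewrite mem_undup mem_cat => ->.
    rewrite (big_support (t := undup (s ++ s')) us') ?undup_uniq -?tE -?uE //.
    by move=> i; rewrite mem_undup mem_cat orbC => ->.
Qed.

(** A nonzero vector has a nonzero projection; a functional that does not
    vanish on it, composed with the projection, is supported on one weight. *)
Lemma graded_dual_sep (K A : eqType) (W : lmodType F) (gr : K -> set W)
    (wt : A -> K) P (t : W) : projections gr wt P ->
  (forall f, graded_dual gr f -> f t = 0) -> t = 0.
Proof.
case=> P0 Psum ft; have [s [us _ tE]] := Psum t.
rewrite tE big1 // => a _; apply/eqP; apply: contraT => /functional_neq0[g].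
rewrite -[g _]/((g \o P a) t) ft ?eqxx //.
exists [:: wt a] => k; rewrite inE => nk w grw /=.
by rewrite (P0 _ _ _ grw) ?linear0.
Qed.

End Projections.

(** * Graded tensor products and the transposition *)

Section GradedTensor.
Local Open Scope classical_set_scope.
Variable F : fieldType.

Lemma tensor_grading_pure (I J K : Type) (add : I -> J -> K) (V W : lmodType F)
    (gV : I -> set V) (gW : J -> set W) i j v w :
  gV i v -> gW j w -> tensor_grading add gV gW (add i j) (pure v w).
Proof.
move=> vi wj; exists [:: (1, pure v w)]; last by rewrite big_seq1 scale1r.
by move=> p; rewrite inE => /eqP -> /=; exists i, j, v, w.
Qed.

Lemma tensor_grading_ker (I J K : Type) (add : I -> J -> K) (V W U : lmodType F)
    (gV : I -> set V) (gW : J -> set W) (k : K) (f : {linear tensor V W -> U}) :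
  (forall i j v w, add i j = k -> gV i v -> gW j w -> f (pure v w) = 0) ->
  forall t, tensor_grading add gV gW k t -> f t = 0.
Proof.
move=> f0; apply: span_ker => _ [i [j [v [w [ijk vi wj ->]]]]].
exact: (f0 i j).
Qed.

Lemma graded_ker (I : eqType) (W U : lmodType F) (gr : I -> set W)
    (f : {linear W -> U}) : graded_space gr ->
  (forall i w, gr i w -> f w = 0) -> forall w, f w = 0.
Proof.
move=> [_ gen _] f0 w; have [s [h [_ hs ->]]] := gen w.
by rewrite linear_sum big1_seq // => i /andP[_ si]; apply/(f0 i)/hs.
Qed.

Lemma graded_tensor_ker (I J : eqType) (V W U : lmodType F) (gV : I -> set V)
    (gW : J -> set W) (f : {linear tensor V W -> U}) :
  graded_space gV -> graded_space gW ->
  (forall i j v w, gV i v -> gW j w -> f (pure v w) = 0) -> forall t, f t = 0.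
Proof.
move=> grV grW f0; apply: tensor_ind => [|v w|t u ft fu].
- exact: linear0.
- apply: (graded_ker (f := f \o pure v) grW) => j {}w wj /=.
  exact: (graded_ker (f := f \o applyr pure w) grV
    (fun i v vi => f0 i j v w vi wj)).
- by rewrite linearD ft fu addr0.
Qed.

(** An element of the graded dual involves finitely many weights. *)
Lemma graded_dual_bound (W : lmodType F) (gr : rat -> set W)
    (f : {linear W -> F^o}) : graded_dual gr f ->
  exists D : int, forall k w, D%:~R <= k -> gr k w -> f w = 0.
Proof.
case=> s fs.
suff [D DP] : exists D : int, forall k, k \in s -> k < D%:~R.
  exists D => k w Dk; apply: fs; apply/negP => /DP.
  by rewrite ltNge Dk.
elim: s {fs} => [|x s [D DP]]; first by exists 0.
exists (Num.max D (Num.floor x + 1)) => k; rewrite inE => /predU1P[->|/DP kD].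
  by apply: lt_le_trans (floorD1_gt x) _; rewrite ler_int le_max lexx orbT.
by apply: lt_le_trans kD _; rewrite ler_int le_max lexx.
Qed.

End GradedTensor.

Section Swap.
Variable F : fieldType.

Lemma tswap12_pure (V M : lmodType F) (u v : V) (m : M) :
  tswap12 V M (pure u (pure v m)) = pure v (pure u m).
Proof.
by rewrite /tswap12 /= tassocV_pure tmap_pure tswap_pure tassoc_pure.
Qed.

Lemma tensor3_ext (U V W X : lmodType F)
    (f g : {linear tensor U (tensor V W) -> X}) :
  (forall u v w, f (pure u (pure v w)) = g (pure u (pure v w))) -> f =1 g.
Proof.
move=> fg; apply: tensor_ext => u t.
exact: (tensor_ext (g := f \o pure u) (h := g \o pure u) (fg u)).
Qed.

Lemma tswap12K (V M : lmodType F) : involutive (tswap12 V M).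
Proof.
move=> t; apply: (tensor3_ext (f := tswap12 V M \o tswap12 V M) (g := idfun)).
move=> u v m; rewrite [LHS](congr1 (tswap12 V M) (tswap12_pure _ _ _)).
exact: tswap12_pure.
Qed.

Lemma tswap12_tassoc (V M : lmodType F) (t : tensor V V) (m : M) :
  tswap12 V M (tassoc V V M (pure t m)) = tassoc V V M (pure (tswap V V t) m).
Proof.
apply: (tensor_ext (g := tswap12 V M \o tassoc V V M \o applyr pure m)
  (h := tassoc V V M \o applyr pure m \o tswap V V)) => u v.
change (tswap12 V M (tassoc V V M (pure (pure u v) m)) =
  tassoc V V M (pure (tswap V V (pure u v)) m)).
by rewrite tassoc_pure tswap12_pure tswap_pure tassoc_pure.
Qed.

Lemma sgzS (a : int) : (-1 : F) ^ (a + 1) = - (-1) ^ a.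
Proof. by rewrite expfzDr ?oppr_eq0 ?oner_eq0 // expr1z mulrN1. Qed.

Lemma sgzN (a : int) : (-1 : F) ^ (- a) = (-1) ^ a.
Proof. by rewrite -exprz_inv invrN1. Qed.

Lemma sgz_sq (a : int) : (-1 : F) ^ a * (-1) ^ a = 1.
Proof. by rewrite -[X in X * _]sgzN -expfzDr ?oppr_eq0 ?oner_eq0 // addNr. Qed.

Lemma sgz_opp1 (a : int) : (-1 : F) ^ (- a - 1) = - (-1) ^ a.
Proof. by rewrite -[LHS]sgzN -sgzS; congr (_ ^ _); lia. Qed.

End Swap.

(** * Weights of the coactions and of the counit *)

Section DualComp.
Local Open Scope classical_set_scope.
Variables (F : fieldType) (V M : lmodType F).
Variables (gV : int -> set V) (gM : rat -> set M).

Lemma triple_grading_ker (U : lmodType F) (k : rat)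
    (f : {linear tensor V (tensor V M) -> U}) :
  (forall i i' j u v m, addzq i (addzq i' j) = k -> gV i u -> gV i' v ->
    gM j m -> f (pure u (pure v m)) = 0) ->
  forall t, tensor_grading addzq gV (tensor_grading addzq gV gM) k t -> f t = 0.
Proof.
move=> f0; apply: tensor_grading_ker => i l u t il ui.
apply: (tensor_grading_ker (f := f \o pure u)) => i' j v m i'j vi' mj.
by apply: (f0 i i' j) => //; rewrite i'j.
Qed.

Lemma triple_dual_swap (f : {linear tensor V (tensor V M) -> F^o}) :
  triple_dual gV gM f -> triple_dual gV gM (f \o tswap12 V M).
Proof.
case=> s fs; exists s => k ks; apply: triple_grading_ker.
move=> i i' j u v m ijk ui vi' mj.
change (f (tswap12 V M (pure u (pure v m))) = 0); rewrite tswap12_pure.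
apply: (fs k ks); have -> : k = addzq i' (addzq i j).
  by rewrite -ijk /addzq addrCA.
by do 2!apply: tensor_grading_pure => //.
Qed.

Lemma triple_dual_counit (c : {linear V -> F^o})
    (f : {linear tensor V M -> F^o}) :
  (forall i v, i != 0 -> gV i v -> c v = 0) ->
  graded_dual (tensor_grading addzq gV gM) f ->
  triple_dual gV gM (f \o tmap idfun (contractl M c)).
Proof.
move=> c0 [s fs]; exists s => k ks; apply: triple_grading_ker.
move=> i i' j u v m ijk ui vi' mj.
change (f (tmap idfun (contractl M c) (pure u (pure v m))) = 0).
rewrite tmap_pure [contractl M c _]tlift_pure /= /contractl_fun.
have [i'0|i'0] := eqVneq i' 0; last first.
  by rewrite (c0 i') // scale0r linear0r linear0.
have kE : k = addzq i j by rewrite -ijk i'0 /addzq add0r.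
rewrite linearZr_LR linearZ (fs k ks (pure u m)); first exact: mulr0.
by rewrite kE; apply: tensor_grading_pure.
Qed.

Variables (c : {linear V -> F^o}) (YM : {linear M -> fseries (tensor V M)}).
Hypothesis grV : graded_space gV.
Hypothesis lowV : lower_truncated gV.
Hypothesis comM : comodule_without_jacobi c gV YM gM.

Lemma coaction_weight (j : rat) (m : M) (p : int) : gM j m ->
  tensor_grading addzq gV gM (j - p%:~R) (YM m p).
Proof.
move=> mj; have := com_weight comM (- p - 1) mj; rewrite /Delta.
have -> : - (- p - 1) - 1 = p by lia.
by rewrite rmorphB rmorphN /= addrA subrK.
Qed.

(** The coefficient of x^n lowers weights by n, so it raises them beyond the
    support of f when n is very negative.  The bound is uniform in w because
    the weights of M are bounded below. *)
Lemma coaction_low (f : {linear tensor V M -> F^o}) :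
  graded_dual (tensor_grading addzq gV gM) f ->
  exists y0 : int, forall n w, n < y0 -> f (YM w n) = 0.
Proof.
move=> /graded_dual_bound[D fD]; have [N NM] := com_lower comM.
exists (Num.floor N - D) => n w ny; move: w.
apply: (graded_ker (f := f \o ycoef YM n) (com_graded comM)) => j w wj.
change (f (YM w n) = 0).
have [/NM /(_ _ wj) ->|Nj] := ltP j N; first by rewrite !linear0.
apply: fD (coaction_weight n wj).
have := floor_le N; have : (n + D)%:~R < (Num.floor N)%:~R :> rat.
  by rewrite ltr_int; lia.
rewrite rmorphD /=; lra.
Qed.

(** As for [coaction_low], with the weights of both V and M bounded below. *)
Lemma coaction_right_low (f : {linear tensor V (tensor V M) -> F^o}) :
  triple_dual gV gM f -> exists p0 : int, forall p t, p < p0 ->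
    f (tmap idfun (ycoef YM p) t) = 0.
Proof.
move=> /graded_dual_bound[D fD]; have [N NM] := com_lower comM.
have [N' NV] := lowV.
exists (N' + Num.floor N - D) => p t pp; move: t.
apply: (graded_tensor_ker (f := f \o tmap idfun (ycoef YM p)) grV
  (com_graded comM)) => i j v w vi wj.
change (f (tmap idfun (ycoef YM p) (pure v w)) = 0).
rewrite tmap_pure.
have [/NM /(_ _ wj) ->|Nj] := ltP j N; first by rewrite !(linear0, linear0r).
have [/NV /(_ _ vi) ->|Ni] := ltP i N'; first by rewrite linear0l linear0.
apply: (fD _ _ _ (tensor_grading_pure addzq vi (coaction_weight p wj))).
have := floor_le N.
have : (p + D)%:~R < (N' + Num.floor N)%:~R :> rat by rewrite ltr_int; lia.
have : N'%:~R <= i%:~R :> rat by rewrite ler_int.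
rewrite /addzq !rmorphD /=; lra.
Qed.

End DualComp.

(** Let c_r be the restriction of c to weight r.  Since the constant term
    Y_0 of Y_V preserves weights, (c_r ⊗ Id) Y_0 v is the weight-0 part of
    (c ⊗ Id) Y_0 v = v, hence zero when v has weight r != 0.  Applying c gives
    0 = (c_r ⊗ c) Y_0 v = c_r ((Id ⊗ c) Y_0 v) = c v by cocreation. *)
Lemma counit_weight0 (F : fieldType) (V : lmodType F)
    (YV : {linear V -> fseries (tensor V V)}) (c : {linear V -> F^o})
    (gV : int -> set V) : graded_vertex_coalgebra YV c gV ->
  forall r v, r != 0 -> gV r v -> c v = 0.
Proof.
case=> -[ccounit ccoc _ _] grV _ wt r v r0 vr.
have [P PP] := graded_projections grV; have [P0 _] := PP.
have wYv : tensor_grading +%R gV gV r (YV v 0).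
  by have := wt r (-1) v vr; rewrite /Delta subrK opprK subrr.
have cPr t : tensor_grading +%R gV gV r t ->
    P 0 (contractl V c t) = contractl V (c \o P r) t.
  move=> tr; apply/eqP; rewrite -subr_eq0; apply/eqP.
  apply: (tensor_grading_ker
    (f := (P 0 \o contractl V c) \- contractl V (c \o P r))) tr.
  move=> i j u u' ij ui u'j.
  change (P 0 (contractl V c (pure u u')) -
    contractl V (c \o P r) (pure u u') = 0).
  rewrite [contractl _ _ _]tlift_pure [X in _ - X]tlift_pure.
  change (P 0 (c u *: u') - c (P r u) *: u' = 0).
  rewrite linearZ /=; have [e|i'r] := eqVneq i r.
    have j0 : j = 0 by lia.
    rewrite e in ui; rewrite j0 in u'j.
    by rewrite (projections_id PP ui) (projections_id PP u'j) subrr.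
  rewrite (P0 r i u) // linear0 scale0r subr0 (P0 0 j) ?scaler0 //; lia.
have ccE t : c (P r (contractr V c t)) = c (contractl V (c \o P r) t).
  apply: (tensor_ext (g := c \o P r \o contractr V c)
    (h := c \o contractl V (c \o P r))) => u u'.
  change (c (P r (contractr V c (pure u u'))) =
    c (contractl V (c \o P r) (pure u u'))).
  rewrite [contractr _ _ _]tlift_pure [contractl _ _ _]tlift_pure.
  change (c (P r (c u' *: u)) = c (c (P r u) *: u')).
  by rewrite !linearZ; apply: mulrC.
rewrite -(projections_id PP vr) -{1}(ccoc v).2 ccE -cPr // ccounit eqxx.
by rewrite (P0 0 r v) ?linear0.
Qed.

(** * The Jacobi identity in coefficients *)

Section Jacobi.
Local Open Scope classical_set_scope.
Variables (F : fieldType) (V M : lmodType F).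
Variables (YV : {linear V -> fseries (tensor V V)}).
Variables (YM : {linear M -> fseries (tensor V M)}).
Notation R := (coact_right YM).
Notation L := (coact_left YV YM).
Notation T := (tswap12 V M).

(** Coefficients of x0^a x1^b x2^c in the first and the third term of the
    Jacobi identity.  The second term is, up to sign, the image of the first
    one under T, x1 <-> x2 and x0 -> -x0. *)
Definition prod_term w (a b c : int) := negbin_mul 1 a (R w) c (a + b + 1).
Definition iter_term w (a b c : int) := negbin_mul (-1) b (L w) a (b + c + 1).
Definition jacobiator w a b c :=
  prod_term w a b c + (-1) ^ a *: T (prod_term w a c b) - iter_term w a b c.

Lemma smul_delta_12_0 w (a b c : int) :
  smul (@delta_12_0 F)
    (fun '(a, b, c) => if a == 0 then R w c b else 0) (a, b, c)
  = prod_term w a b c.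
Proof.
rewrite /smul (@fsum_inj _ _ (fun m : nat => (a, - a - 1 - m%:Z, m%:Z))).
- apply: eq_fsbigr => m _; rewrite /delta_12_0 /binpow subrK eqxx /=.
  rewrite subrr eqxx mulrC binz_neg expr1n mul1r.
  by congr (_ *: R w _ _); lia.
- by move=> m m' [].
- move=> [[x y] z] nz /=; have [ax|ax] := eqVneq (a - x) 0; last first.
    by rewrite scaler0.
  rewrite /binpow; case: z nz => [m|m] nz; last by rewrite scale0r.
  case: eqP => [e|_]; last by rewrite scale0r.
  by case: (nz m); congr (_, _, _); lia.
Qed.

Lemma smul_delta_21_0 w (a b c : int) : bounded_above (R w) ->
  smul (@delta_21_0 F)
    (fun '(a, b, c) => if a == 0 then T (R w b c) else 0) (a, b, c)
  = - ((-1) ^ a *: T (prod_term w a c b)).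
Proof.
move=> RB; rewrite /prod_term linear_negbin_mul //.
have [N eN] : exists N, forall m, (N <= m)%N ->
    R w (b - m%:Z) (a + c + 1 + m%:Z) = 0.
  case: RB => B RB; exists (absz (B - (a + c + 1))%R).+1 => m Nm.
  by apply: RB; lia.
rewrite (@negbin_mulE _ _ _ _ _ _ _ N); last first.
  by move=> m /eN ->; rewrite linear0.
rewrite -scaleNr -sgz_opp1 scaler_sumr.
rewrite /smul (@fsum_inj _ _ (fun m : nat => (a, m%:Z, - a - 1 - m%:Z))).
- have g m : R w (b - m%:Z) (c - (- a - 1 - m%:Z)) =
      R w (b - m%:Z) (a + c + 1 + m%:Z).
    by congr (R w _ _); lia.
  rewrite (@fsum_nat _ _ N) => [|m Nm] /=; rewrite /delta_21_0 /binpow;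
    last first.
    by rewrite subrr eqxx g eN // !linear0.
  apply: eq_bigr => m _; rewrite subrK eqxx /=.
  rewrite subrr eqxx mulrC scalerA mulrC [_ * (-1) ^+ m]mulrC binz_neg.
  by rewrite expr1n mul1r g.
- by move=> m m' [].
- move=> [[x y] z] nz /=; have [ax|ax] := eqVneq (a - x) 0; last first.
    by rewrite scaler0.
  rewrite /binpow; case: y nz => [m|m] nz; last by rewrite mulr0 scale0r.
  case: eqP => [e|_]; last by rewrite mulr0 scale0r.
  by case: (nz m); congr (_, _, _); lia.
Qed.

Lemma smul_delta_10_2 w (a b c : int) :
  smul (@delta_10_2 F)
    (fun '(a, b, c) => if b == 0 then L w a c else 0) (a, b, c)
  = iter_term w a b c.
Proof.
rewrite /smul (@fsum_inj _ _ (fun m : nat => (m%:Z, b, - b - 1 - m%:Z))).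
- apply: eq_fsbigr => m _; rewrite /delta_10_2 /binpow.
  have -> : - (- b - 1 - m%:Z) - 1 = b + m%:Z by lia.
  rewrite eqxx /= subrr eqxx mulrC.
  by congr (_ *: L w _ _); lia.
- by move=> m m' [].
- move=> [[x y] z] nz /=; have [ax|ax] := eqVneq (b - y) 0; last first.
    by rewrite scaler0.
  rewrite /binpow; case: x nz => [m|m] nz; last by rewrite scale0r.
  case: eqP => [e|_]; last by rewrite scale0r.
  by case: (nz m); congr (_, _, _); lia.
Qed.

Hypothesis truncM : forall w, upper_truncated (YM w).

Lemma coact_right_bounded w : bounded_above (R w).
Proof.
case: (truncM w) => N YN; exists N => p q /YN; rewrite /coact_right => ->.
exact: linear0.
Qed.

Lemma coact_left_bounded w : bounded_above (L w).
Proof.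
case: (truncM w) => N YN; exists N => p q /YN; rewrite /coact_left => ->.
by rewrite !linear0.
Qed.

Lemma jacobi_identityE :
  jacobi_identity YV YM <-> forall w a b c, jacobiator w a b c = 0.
Proof.
have E w a b c : jacobiator w a b c = (smul (@delta_12_0 F)
    (fun '(a, b, c) => if a == 0 then R w c b else 0)
  \- smul (@delta_21_0 F)
    (fun '(a, b, c) => if a == 0 then T (R w b c) else 0)) (a, b, c)
  - smul (@delta_10_2 F)
    (fun '(a, b, c) => if b == 0 then L w a c else 0) (a, b, c).
  by rewrite /= smul_delta_12_0 smul_delta_21_0 ?opprK ?smul_delta_10_2 //;
    apply: coact_right_bounded.
split=> [J w a b c|J w]; first by rewrite E J subrr.
apply/funext => -[[a b] c]; apply/eqP; rewrite -subr_eq0; apply/eqP.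
by rewrite -E.
Qed.

Hypothesis F0 : [pchar F] =i pred0.

Lemma prod_term_rel w (a b c : int) :
  prod_term w (a - 1) b c = prod_term w a (b - 1) c - prod_term w a b (c - 1).
Proof.
rewrite /prod_term; have -> : a - 1 + b + 1 = a + b by lia.
rewrite negbin_mul_pascal //; last exact: coact_right_bounded.
by rewrite scale1r; congr (negbin_mul _ _ _ _ _ - _); lia.
Qed.

Lemma iter_term_rel w (a b c : int) :
  iter_term w (a - 1) b c = iter_term w a (b - 1) c - iter_term w a b (c - 1).
Proof.
rewrite /iter_term; have -> : b - 1 + c + 1 = b + c by lia.
rewrite negbin_mul_pascal //; last exact: coact_left_bounded.
rewrite scaleN1r opprK; have -> : b + (c - 1) + 1 = b + c by lia.
by rewrite [RHS]addrAC subrr add0r.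
Qed.

(** x1 - x2 - x0 is changed to its opposite by x1 <-> x2 and x0 -> -x0. *)
Lemma swap_rel (j : int -> int -> int -> tensor V (tensor V M)) :
  (forall a b c, j (a - 1) b c = j a (b - 1) c - j a b (c - 1)) ->
  forall a b c, (-1) ^ (a - 1) *: T (j (a - 1) c b) =
    (-1) ^ a *: T (j a c (b - 1)) - (-1) ^ a *: T (j a (c - 1) b).
Proof.
move=> rel a b c; rewrite rel -scalerBr -linearB -[in RHS](subrK 1 a) sgzS.
by rewrite scaleNr -scalerN -linearN opprB subrK.
Qed.

Lemma jacobiator_rel w (a b c : int) : jacobiator w (a - 1) b c =
  jacobiator w a (b - 1) c - jacobiator w a b (c - 1).
Proof.
rewrite /jacobiator (swap_rel (prod_term_rel w)) prod_term_rel iter_term_rel.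
by rewrite !opprD !opprK [X in X + _ = _]addrACA [LHS]addrACA.
Qed.

(** The residue in x1 turns x0^-1 delta((x1 - x2) / x0) into the substitution
    x1 = x0 + x2. *)
Lemma coassoc_rightE w (a c : int) :
  coassoc_right YM w (a, c) = prod_term w a (-1) c.
Proof.
have sE j : subst_add (YM w) (a, j) =
    if j is Posz m then binz F (a + m%:Z) m *: YM w (a + m%:Z) else 0.
  rewrite /subst_add; case: j => [m|m] /=; last first.
    by apply: fsbig1 => n _; rewrite scale0r.
  rewrite (fsbigE [:: a + m%:Z]) //= => [|n _]; last first.
    by rewrite inE eq_sym => /negPf ->; rewrite scale0r.
  by rewrite big_cons big_nil ifT ?inE // addr0 eqxx expr1n mulr1.
rewrite /coassoc_right (@fsum_inj _ _ Posz) => [|m m' []|] //; last first.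
  by case=> [m nm|m _]; [case: (nm m) | rewrite sE linear0].
by apply: eq_fsbigr => m _; rewrite sE linearZ expr1n mul1r addrNK.
Qed.

Lemma iter_term_left w (a c : int) :
  iter_term w a (-1) c = coassoc_left YV YM w (a, c).
Proof. by rewrite /iter_term negbin_mulN1 // addrC addrCA addKr. Qed.

End Jacobi.

(** * Skew-symmetry of the coalgebra *)

Section Contractions.
Variables (F : fieldType) (V : lmodType F).
Variables (YV : {linear V -> fseries (tensor V V)}) (c : {linear V -> F^o}).

(** The coefficient of x^p in (Id ⊗ c) Y_V(x) = exp(x D): it stands for
    D^p / p!, where D is the coderivation of V. *)
Definition transl (p : int) : {linear V -> V} := contractr V c \o ycoef YV p.

Section Module.
Variables (M : lmodType F) (YM : {linear M -> fseries (tensor V M)}).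

Lemma counit_coact_right w p q : left_counit c YM ->
  tmap idfun (contractl M c) (coact_right YM w p q) =
  if p == 0 then YM w q else 0.
Proof.
move=> cM; rewrite /coact_right.
elim/tensor_ind: (YM w q) => [|v m|t u IHt IHu].
- by rewrite !linear0; case: eqP.
- rewrite [X in tmap _ _ X]tmap_pure tmap_pure.
  rewrite -[contractl M c _]/(contractl M c (YM m p)) cM.
  by case: eqP; rewrite // linear0r.
- by rewrite !linearD IHt IHu; case: eqP; rewrite ?addr0.
Qed.

Lemma counit_coact_left w p q :
  tmap idfun (contractl M c) (coact_left YV YM w p q) =
  tmap (transl p) idfun (YM w q).
Proof.
rewrite /coact_left; elim/tensor_ind: (YM w q) => [|v m|t u IHt IHu].
- by rewrite !linear0.
- rewrite [tmap _ _ (pure v m)]tmap_pure [RHS]tmap_pure /=.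
  change (tmap idfun (contractl M c) (tassoc V V M (pure (YV v p) m)) =
    pure (contractr V c (YV v p)) m).
  elim/tensor_ind: (YV v p) => [|u u'|t u IHt IHu].
  + by rewrite linear0 !linear0l !linear0.
  + rewrite tassoc_pure tmap_pure [contractl _ _ _]tlift_pure.
    rewrite [contractr _ _ _]tlift_pure.
    change (pure u ((c u' : F) *: m) = pure ((c u' : F) *: u) m).
    by rewrite pureZl pureZr.
  + by rewrite linearD !linearDl !linearD IHt IHu.
- by rewrite !linearD IHt IHu.
Qed.

End Module.

Lemma cocreation_coact_right w p q :
  tmap idfun (contractr V c) (coact_right YV w p q) =
  tmap idfun (transl p) (YV w q).
Proof.
rewrite /coact_right; elim/tensor_ind: (YV w q) => [|v m|t u IHt IHu].
- by rewrite !linear0.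
- by rewrite [X in tmap _ _ X]tmap_pure !tmap_pure.
- by rewrite !linearD IHt IHu.
Qed.

Lemma cocreation_coact_left w p q :
  tmap idfun (contractr V c) (coact_left YV YV w p q) = YV (transl q w) p.
Proof.
rewrite -[YV _ p]/(ycoef YV p (contractr V c (YV w q))) /coact_left.
elim/tensor_ind: (YV w q) => [|v m|t u IHt IHu].
- by rewrite !linear0.
- rewrite [tmap _ _ (pure v m)]tmap_pure [contractr V c _]tlift_pure.
  change (tmap idfun (contractr V c) (tassoc V V V (pure (ycoef YV p v) m)) =
    ycoef YV p ((c m : F) *: v)); rewrite linearZ.
  elim/tensor_ind: (ycoef YV p v) => [|u u'|t u IHt IHu].
  + by rewrite linear0l !linear0 /= scaler0.
  + rewrite tassoc_pure tmap_pure [contractr _ _ _]tlift_pure.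
    change (pure u ((c m : F) *: u') = (c m : F) *: pure u u').
    by rewrite pureZr.
  + by rewrite linearDl !linearD IHt IHu /= scalerDr.
- by rewrite !linearD IHt IHu.
Qed.

Lemma contractr_tswap12 (M : lmodType F) (cM : {linear M -> F^o}) t :
  tmap idfun (contractr V cM) (tswap12 V M t) =
  tswap V V (tmap idfun (contractr V cM) t).
Proof.
apply: (tensor3_ext (f := tmap idfun (contractr V cM) \o tswap12 V M)
  (g := tswap V V \o tmap idfun (contractr V cM))) => u v m.
change (tmap idfun (contractr V cM) (tswap12 V M (pure u (pure v m))) =
  tswap V V (tmap idfun (contractr V cM) (pure u (pure v m)))).
rewrite tswap12_pure !tmap_pure tswap_pure.
rewrite [contractr _ _ _]tlift_pure [contractr _ _ (pure v m)]tlift_pure.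
change (pure v ((cM m : F) *: u) = pure ((cM m : F) *: v) u).
by rewrite pureZl pureZr.
Qed.

Hypothesis vcV : vertex_coalgebra YV c.

Lemma transl_neg p : p < 0 -> transl p =1 (fun=> 0).
Proof. by move=> p0 v; apply: (vc_cocreation vcV v).1. Qed.

Lemma transl0 : transl 0 =1 id.
Proof. by move=> v; apply: (vc_cocreation vcV v).2. Qed.

Lemma transl_large v :
  exists N : nat, forall m : nat, (N <= m)%N -> transl m%:Z v = 0.
Proof.
have [B YB] := vc_truncation vcV v; exists (absz B).+1 => m Bm.
change (contractr V c (YV v m%:Z) = 0); rewrite YB ?linear0 //; lia.
Qed.

Lemma tmap_neg (M : lmodType F) p (t : tensor M V) :
  p < 0 -> tmap idfun (transl p) t = 0.
Proof.
move=> p0; elim/tensor_ind: t => [|u v|t u IHt IHu]; first exact: linear0.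
  by rewrite tmap_pure transl_neg // linear0r.
by rewrite linearD IHt IHu addr0.
Qed.

Lemma tmap_transl0 (M : lmodType F) (t : tensor M V) :
  tmap idfun (transl 0) t = t.
Proof.
elim/tensor_ind: t => [|u v|t u IHt IHu]; first exact: linear0.
  by rewrite tmap_pure transl0.
by rewrite linearD IHt IHu.
Qed.

(** T Y_V(x) = Y_V(-x) exp(x D).  After contraction of the third factor with
    c, the first term of the Jacobi identity has no negative power of x2 and
    the second one no negative power of x1.  So the coefficient of
    x0^p x1^0 x2^-1 loses the first term and keeps a single summand of the
    second. *)
Lemma skew_symmetry v p : tswap V V (YV v p) =
  (-1) ^ p *: negbin_mul (-1) 0 (fun a b => YV (transl b v) a) p 0.
Proof.
have truncV := vc_truncation vcV.
have RB := coact_right_bounded truncV v.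
have LB := coact_left_bounded YV truncV v.
have /(jacobi_identityE YV truncV) J := vc_jacobi vcV.
have := congr1 (tmap idfun (contractr V c)) (J v p 0 (-1)).
rewrite /jacobiator linear0 linearB linearD linearZ contractr_tswap12.
rewrite /prod_term /iter_term !(linear_negbin_mul _ _ _ RB).
rewrite (linear_negbin_mul _ _ _ LB) addr0 addrNK.
rewrite (_ : negbin_mul 1 p _ (-1) _ = 0); last first.
  apply: fsbig1 => m _.
  by rewrite cocreation_coact_right tmap_neg ?scaler0 //; lia.
rewrite [X in tswap _ _ X]negbin_mul_eq => [|m m0]; last first.
  by rewrite cocreation_coact_right tmap_neg //; lia.
rewrite cocreation_coact_right tmap_transl0 add0r.
move/eqP; rewrite subr_eq0 => /eqP.
rewrite (@eq_negbin_mul _ _ _ _ _ (fun a b => YV (transl b v) a)) => [E|a b];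
  last exact: cocreation_coact_left.
by rewrite -E scalerA sgz_sq scale1r.
Qed.

End Contractions.

(** * From weak coassociativity to the Jacobi identity *)

Section TwoExpansions.
Variables (F : fieldType) (F0 : [pchar F] =i pred0).

(** The coefficient of x0^a x2^c in (x0 + x2)^(a+c); exchanging the arguments
    gives the one in (x2 + x0)^(a+c). *)
Definition binpow_add (a c : int) : F :=
  if c is Posz m then binz F (a + m%:Z) m else 0.

Lemma binpow_add_rel a c :
  binpow_add (a - 1) c + binpow_add a (c - 1) = binpow_add a c.
Proof.
case: c => [[|m]|m]; rewrite /binpow_add.
- by rewrite !binz0 addr0.
- have -> : Posz m.+1 - 1 = m by lia.
  have -> : a + m.+1%:Z = a + m%:Z + 1 by lia.
  have -> : a - 1 + m.+1%:Z = a + m%:Z by lia.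
  by rewrite binzS.
- by rewrite (_ : Negz m - 1 = Negz m.+1) ?addr0 // !NegzE; lia.
Qed.

Lemma binpow_addC a c : 0 <= a + c -> binpow_add a c = binpow_add c a.
Proof.
case: a c => [n|n] [m|m] //; rewrite /binpow_add => nm.
- by rewrite -!PoszD !binz_nat // -[in RHS]bin_sub ?leq_addl // addnK addnC.
- have -> : Negz m + n%:Z = (n - m.+1)%N%:Z by lia.
  by rewrite binz_nat // bin_small //; lia.
- have -> : Negz n + m%:Z = (m - n.+1)%N%:Z by lia.
  by rewrite binz_nat // bin_small //; lia.
Qed.

(** The series y(x0 + x2) - y(x2 + x0) is annihilated by a power of x0 + x2 as
    soon as y has finitely many negative powers: each difference
    (x0 + x2)^n - (x2 + x0)^n is multiplied into the one for n + k, which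
    vanishes when n + k >= 0 by [binpow_addC]. *)
Lemma iter_binpow_add (W : lmodType F) (y : int -> W) k a c :
  iter k (@add_mul F W)
    (fun a c => (binpow_add a c - binpow_add c a) *: y (a + c)) a c =
  (binpow_add a c - binpow_add c a) *: y (a + c - k%:Z).
Proof.
elim: k a c => [|k IHk] a c /=; first by rewrite subr0.
rewrite /add_mul !IHk.
have -> : a - 1 + c - k%:Z = a + c - k.+1%:Z by lia.
have -> : a + (c - 1) - k%:Z = a + c - k.+1%:Z by lia.
rewrite -scalerDl; congr (_ *: _).
by rewrite -[in RHS](binpow_add_rel a c) -[in RHS](binpow_add_rel c a)
  opprD addrACA [- _ + - _]addrC.
Qed.

End TwoExpansions.

Section Comodule.
Variables (F : fieldType) (F0 : [pchar F] =i pred0).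
Variables (V : lmodType F) (YV : {linear V -> fseries (tensor V V)}).
Variables (c : {linear V -> F^o}) (gV : int -> set V).
Variables (M : lmodType F) (YM : {linear M -> fseries (tensor V M)}).
Variable gM : rat -> set M.
Hypothesis gvcV : graded_vertex_coalgebra YV c gV.
Hypothesis comM : comodule_without_jacobi c gV YM gM.
Hypothesis weakM : weak_coassociativity YV YM (triple_dual gV gM).

Local Notation vcV := (gvc_coalgebra gvcV).
Local Notation grV := (gvc_graded gvcV).
Local Notation truncM := (com_truncation comM).
Local Notation transl := (transl YV c).
Local Notation jac := (jacobiator YV YM).

Lemma triple_separation t :
  (forall f, triple_dual gV gM f -> f t = 0) -> t = 0.
Proof.
have [P PP] := graded_projections grV.
have [Q PQ] := graded_projections (com_graded comM).
apply: graded_dual_sep.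
exact: (tensor_projections addzq PP (tensor_projections addzq PP PQ)).
Qed.

Lemma double_separation t :
  (forall f, graded_dual (tensor_grading addzq gV gM) f -> f t = 0) -> t = 0.
Proof.
have [P PP] := graded_projections grV.
have [Q PQ] := graded_projections (com_graded comM).
by apply: graded_dual_sep; apply: (tensor_projections addzq PP PQ).
Qed.

(** The exponent of x0 + x2 can be taken arbitrarily large. *)
Lemma weak_coassociativity_iter (f : {linear tensor V (tensor V M) -> F^o}) :
  triple_dual gV gM f -> exists k : nat, forall k' w a b, (k <= k')%N ->
  iter k' (@add_mul F F^o) (fun a b =>
    f (coassoc_left YV YM w (a, b)) - f (coassoc_right YM w (a, b))) a b = 0.
Proof.
move=> /weakM[k _ fk]; exists k => k' w a b kk'.
rewrite -(subnK kk') iterD; apply: iter_add_mul0 => {}a {}b.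
rewrite -smul_binpow // -[RHS](congr1 (fun g => g (a, b)) (fk w)).
by congr (smul _ _ _); apply/funext => -[x y]; rewrite linearB.
Qed.

(** (c ⊗ Id) Y_M(x2) Y_M(x0 + x2) w = Y_M(x0 + x2) w by the left counit. *)
Lemma negbin_mul_counit w a b : negbin_mul 1 a
    (fun p q => tmap idfun (contractl M c) (coact_right YM w p q)) b a =
  binpow_add F a b *: YM w (a + b).
Proof.
rewrite (eq_negbin_mul _ _
  (fun p q => counit_coact_right w p q (com_counit comM))).
case: b => b; last first.
  rewrite scale0r; apply: fsbig1 => m _; case: eqP => [|_]; first lia.
  exact: scaler0.
rewrite /negbin_mul (fsbigE [:: b]) // => [|n _].
  rewrite big_cons big_nil mem_set // [LHS]addr0.
  by rewrite subrr eqxx expr1n mul1r.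
by rewrite inE => nb; rewrite ifF ?scaler0 //; apply/eqP; lia.
Qed.

(** (exp(x0 D) ⊗ Id) Y_M(x2) w = Y_M(x2 + x0) w, with nonnegative powers of
    x0 on both sides.  Contracting weak coassociativity with c in the middle
    factor gives the same equality for Y_M(x0 + x2) w instead, after
    multiplication by (x0 + x2)^K.  For large K the two expansions agree, and
    then the factor is cancelled. *)
Lemma translation w (i : nat) q :
  tmap (transl i) idfun (YM w q) = binz F (q + i%:Z) i *: YM w (q + i%:Z).
Proof.
apply/eqP; rewrite -subr_eq0; apply/eqP; apply: double_separation => f df.
have [k fk] := weak_coassociativity_iter
  (triple_dual_counit (counit_weight0 gvcV) df).
have [y0 fy] := coaction_low comM df.
(* k is for weak coassociativity; the surplus ensures that the coefficient
   of x^(a+b-K) in f (Y_M(x) w) vanishes whenever a + b < 0 *)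
pose K := (k + absz y0)%N.
pose E a b := f (tmap (transl a) idfun (YM w b)) -
  binpow_add F b a *: (f (YM w (a + b)) : F^o).
suff : E i q = 0.
  by move=> e; rewrite linearB linearZ -[RHS]e /E [i%:Z + q]addrC.
apply: (@iter_add_mul_cancel _ _ K) => [a b a0|a b].
  rewrite /E; case: a a0 => // a _; rewrite /binpow_add scale0r subr0.
  rewrite (_ : tmap _ _ _ = 0) ?linear0 //.
  elim/tensor_ind: (YM w b) => [|v m|t u IHt IHu]; first exact: linear0.
    by rewrite tmap_pure (transl_neg vcV) // linear0l.
  by rewrite linearD IHt IHu addr0.
pose X a b : F^o := f (tmap (transl a) idfun (YM w b)) -
  binpow_add F a b *: (f (YM w (a + b)) : F^o).
have EX : E = fun a b => X a b +
    (binpow_add F a b - binpow_add F b a) *: (f (YM w (a + b)) : F^o).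
  apply/funext => a'; apply/funext => b'; rewrite /E /X scalerBl.
  by rewrite addrA subrK.
rewrite EX iter_add_mulD (iter_binpow_add F0 (fun n => f (YM w n) : F^o)).
rewrite -[RHS]addr0; congr (_ + _); last first.
  have [ab0|ab0] := leP 0 (a + b).
    by rewrite binpow_addC // subrr scale0r.
  by rewrite fy ?scaler0 //; lia.
rewrite -[RHS](fk K w a b) ?leq_addr //; congr (iter K _ _ _ _).
apply/funext => a'; apply/funext => b'; rewrite /X.
have -> : tmap (transl a') idfun (YM w b') =
    tmap idfun (contractl M c) (coassoc_left YV YM w (a', b')).
  by rewrite -(counit_coact_left YV c YM).
congr (f _ - _).
change (binpow_add F a' b' *: (f (YM w (a' + b')) : F^o) =
  f (tmap idfun (contractl M c) (coassoc_right YM w (a', b')))).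
rewrite -linearZ coassoc_rightE /prod_term subrK linear_negbin_mul.
  by rewrite negbin_mul_counit.
exact: (coact_right_bounded truncM).
Qed.

(** The number of terms in exp(x D) depends on the vector of V; a tensor
    involves finitely many of these, so a common truncation exists. *)
Lemma skew_tensor p (t : tensor V M) : exists N, forall N', (N <= N')%N ->
  tswap12 V M (tassoc V V M (tmap (ycoef YV p) idfun t)) =
  (-1) ^ p *: \sum_(m < N') (-1) ^+ m *: tassoc V V M
    (tmap (ycoef YV (p - m%:Z)) idfun (tmap (transl m%:Z) idfun t)).
Proof.
elim/tensor_ind: t => [|v m|t u [N1 IHt] [N2 IHu]].
- exists 0%N => N' _; rewrite !linear0 big1 ?scaler0 // => i _.
  by rewrite !linear0.
- have [N vN] := transl_large vcV v; exists N => N' NN'.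
  rewrite tmap_pure tswap12_tassoc.
  change (tassoc V V M (pure (tswap V V (YV v p)) m) = (-1) ^ p *:
   \sum_(m0 < N') (-1) ^+ m0 *: tassoc V V M (tmap (ycoef YV (p - m0%:Z)) idfun
     (tmap (transl m0%:Z) idfun (pure v m)))).
  rewrite (skew_symmetry vcV) linearZl_LR linearZ; congr (_ *: _).
  rewrite (@negbin_mulE _ _ _ _ _ _ _ N'); last first.
    move=> n Nn; rewrite add0r vN ?(leq_trans NN') //.
    by rewrite -[LHS]/(ycoef YV (p - n%:Z) 0) linear0.
  rewrite linear_sumlz linear_sum; apply: eq_bigr => i _.
  rewrite linearZl_LR linearZ !add0r binz_nat // binn mulr1.
  by rewrite !tmap_pure.
- exists (N1 + N2)%N => N' NN'; rewrite !linearD (IHt N') ?(IHu N'); try lia.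
  rewrite -scalerDr -big_split; congr (_ *: _); apply: eq_bigr => i _.
  by rewrite !linearD.
Qed.

(** T (Y_V(x0) ⊗ Id) Y_M(x2) w = (Y_V(-x0) ⊗ Id) Y_M(x2 + x0) w. *)
Lemma swap_coact_left w p q : tswap12 V M (coact_left YV YM w p q) =
  (-1) ^ p *: negbin_mul (-1) q (coact_left YV YM w) p q.
Proof.
have LB := coact_left_bounded YV truncM w.
have [N1 e1] := skew_tensor p (YM w q).
have [N2 e2] := negbin_mul_cut (-1) q LB p q.
rewrite /coact_left (e1 (N1 + N2)%N) ?leq_addr // (e2 (N1 + N2)%N) ?leq_addl //.
congr (_ *: _); apply: eq_bigr => m _.
rewrite translation (linearZ_LR (tmap (ycoef YV (p - m%:Z)) idfun)).
by rewrite (linearZ_LR (tassoc V V M)) scalerA.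
Qed.

(** The difference of the two sides is killed by x1 - x2 - x0, and
    [swap_coact_left] is its vanishing at x2^-1; the relation propagates this
    to all lower powers of x2. *)
Lemma iter_term_swap w a b c' : c' <= -1 ->
  iter_term YV YM w a b c' = (-1) ^ a *: tswap12 V M (iter_term YV YM w a c' b).
Proof.
move=> c1; apply/eqP; rewrite -subr_eq0; apply/eqP.
pose U a b c := iter_term YV YM w a b c -
  (-1) ^ a *: tswap12 V M (iter_term YV YM w a c b).
have Urel a1 b1 c1' : U (a1 - 1) b1 c1' = U a1 (b1 - 1) c1' - U a1 b1 (c1' - 1).
  rewrite /U (swap_rel (iter_term_rel YV truncM F0 w)).
  rewrite (iter_term_rel YV truncM F0).
  by rewrite !opprD !opprK; rewrite [LHS]addrACA.
rewrite -/(U a b c').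
have -> : c' = - 1 - (absz (c' + 1))%:Z by lia.
elim: (absz _) a b => [|n IHn] a' b'; last first.
  have -> : - 1 - n.+1%:Z = - 1 - n%:Z - 1 by lia.
  have /esym/eqP := Urel a' b' (- 1 - n%:Z).
  by rewrite !IHn sub0r oppr_eq0 => /eqP.
rewrite subr0 /U iter_term_left // /iter_term addrK.
change (negbin_mul (-1) b' (coact_left YV YM w) a' b' -
  (-1) ^ a' *: tswap12 V M (coact_left YV YM w a' b') = 0).
by rewrite swap_coact_left scalerA sgz_sq scale1r subrr.
Qed.

Lemma jacobiator_swap w a b c' : c' <= -1 ->
  jac w a b c' = (-1) ^ a *: tswap12 V M (jac w a c' b).
Proof.
move=> c1; rewrite /jacobiator iter_term_swap //.
rewrite (linearB (tswap12 V M)) (linearD (tswap12 V M)).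
rewrite (linearZ_LR (tswap12 V M)).
rewrite scalerBr scalerDr tswap12K scalerA sgz_sq scale1r.
by rewrite [prod_term _ _ _ _ _ + _]addrC.
Qed.

(** For low powers of x1, the middle term drops out by [coaction_right_low]
    and the other two form a multiple of the coassociativity defect by a large
    power of x0 + x2. *)
Lemma jacobiator_low_x1 (f : {linear tensor V (tensor V M) -> F^o}) :
  triple_dual gV gM f ->
  exists B : int, forall w a b c, b <= B -> f (jac w a b c) = 0.
Proof.
move=> df; have [k fk] := weak_coassociativity_iter df.
have [p0 fp] := coaction_right_low grV (gvc_lower gvcV) comM
  (triple_dual_swap df).
exists (Num.min (p0 - 1) (- 1 - k%:Z)) => w a b c'.
rewrite le_min => /andP[bp bk].
pose j a b c : F^o :=
  f (prod_term YM w a b c) - f (iter_term YV YM w a b c).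
have jrel a1 b1 c1 : j (a1 - 1) b1 c1 = j a1 (b1 - 1) c1 - j a1 b1 (c1 - 1).
  rewrite /j (prod_term_rel truncM F0) (iter_term_rel YV truncM F0).
  rewrite !(linearB f).
  by rewrite !opprD !opprK [LHS]addrACA.
have j0 : j a b c' = 0.
  have -> : b = - 1 - (absz (b + 1))%:Z by lia.
  rewrite (iter_add_mul_rel _ _ _ _ jrel).
  rewrite -[LHS]addr0 -[X in _ + X](fk (absz (b + 1)) w a c'); last by lia.
  rewrite -iter_add_mulD; apply: iter_add_mul0 => {}a {}c'.
  by rewrite coassoc_rightE -iter_term_left // addrA subrK subrr.
have T0 : f (tswap12 V M (prod_term YM w a c' b)) = 0.
  rewrite /prod_term -[LHS]/((f \o tswap12 V M) _).
  rewrite linear_negbin_mul; last exact: (coact_right_bounded truncM).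
  apply: fsbig1 => m _; rewrite /coact_right fp ?scaler0 //; lia.
rewrite /jacobiator (linearB f) (linearD f) (linearZ_LR f) T0.
by rewrite scaler0 addr0.
Qed.

Lemma jacobi_from_weak_coassociativity : jacobi_identity YV YM.
Proof.
apply/(jacobi_identityE YV truncM) => w a b c'.
apply: triple_separation => f df.
have [B fB] := jacobiator_low_x1 df.
have [C fC] := jacobiator_low_x1 (triple_dual_swap df).
apply: (@delta_rel_eq0 _ F^o (fun a b c => f (jac w a b c)) B (Num.min C (-1))).
- by move=> {}a {}b {}c'; rewrite -(linearB f) -(jacobiator_rel YV truncM F0).
- by move=> {}a {}b {}c'; apply: fB.
- move=> {}a {}b {}c'; rewrite le_min => /andP[cC c1].
  rewrite jacobiator_swap // (linearZ_LR f) -[f _]/((f \o tswap12 V M) _) fC //.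
  exact: scaler0.
Qed.

End Comodule.

Unset Implicit Arguments.

Theorem proposition4p8 (F : fieldType) (F0 : [pchar F] =i pred0)
  (V : lmodType F) (YV : {linear V -> fseries (tensor V V)})
  (c : {linear V -> F^o}) (gV : int -> set V)
  (M : lmodType F) (YM : {linear M -> fseries (tensor V M)})
  (gM : rat -> set M) :
  graded_vertex_coalgebra YV c gV ->
  comodule_without_jacobi c gV YM gM ->
  weak_coassociativity YV YM (triple_dual gV gM) ->
  jacobi_identity YV YM.
Proof.
exact: jacobi_from_weak_coassociativity.
Qed.
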